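(* There exists a constant $C>0$ such that every graph $G$ with average degree at least $C$ contains two nested cycles without crossings; that is, $G$ contains cycles $C_1=v_1v_2\dots v_{\ell}$ and $C_2$ such that $V(C_2)\subseteq V(C_1)$, $E(C_1)\cap E(C_2)=\varnothing$, and $C_2$ has no two edges $v_iv_{i'}$ and $v_jv_{j'}$ with $i<j<i'<j'$.
   Context: Graphs are finite and simple. The average degree of a graph $G$ is $d(G)=2e(G)/|G|$, where $e(G)$ is the number of edges and $|G|$ the number of vertices. Cycles $C_1,C_2$ in $G$ are nested if $V(C_2)\subseteq V(C_1)$, and edge-disjoint nested if in addition $E(C_1)\cap E(C_2)=\varnothing$. Two edge-disjoint nested cycles $C_1=v_1\dots v_{\ell}$ (vertices listed in the cyclic order of $C_1$) and $C_2$ are called nested cycles without crossings if $C_2$ has no two edges $v_iv_{i'}$ and $v_jv_{j'}$ with $i<j<i'<j'$. *)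

(* Defs.v *)
From mathcomp Require Import all_boot all_order all_algebra.

Set Implicit Arguments.
Unset Strict Implicit.
Unset Printing Implicit Defensive.

Import GRing.Theory Num.Theory.

Definition simple_graph (T : finType) (e : rel T) : Prop :=
  symmetric e /\ irreflexive e.

(* An edge is the unordered pair of its endpoints. *)
Definition edges (T : finType) (e : rel T) : {set {set T}} :=
  [set [set p.1; p.2] | p : T * T & e p.1 p.2].

(* Division by zero gives the graph without vertices average degree 0. *)
Definition avg_degree (T : finType) (e : rel T) : rat :=
  ((2 * #|edges e|)%:R / #|T|%:R)%R.

(* The list of the vertices of a cycle in cyclic order. The predicate ucycle
   alone would also accept the empty list and the two traversals of an edge. *)
Definition graph_cycle (T : finType) (e : rel T) (c : seq T) : Prop :=
  2 < size c /\ ucycle e c.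

Definition cycle_edges (T : finType) (c : seq T) : {set {set T}} :=
  [set [set x; next c x] | x in c].

Definition nested (T : finType) (c1 c2 : seq T) : Prop :=
  {subset c2 <= c1}.

Definition edge_disjoint_nested (T : finType) (c1 c2 : seq T) : Prop :=
  nested c1 c2 /\ [disjoint cycle_edges c1 & cycle_edges c2].

(* The order of the indices depends on the vertex at which the list c1 starts,
   but crossing does not: rotating or reversing c1 preserves it. *)
Definition crossing (T : finType) (c1 c2 : seq T) : Prop :=
  let v := tnth (in_tuple c1) in
  exists i j i' j' : 'I_(size c1),
    [/\ i < j, j < i', i' < j',
        [set v i; v i'] \in cycle_edges c2 &
        [set v j; v j'] \in cycle_edges c2].

Definition nested_without_crossings (T : finType) (c1 c2 : seq T) : Prop :=
  edge_disjoint_nested c1 c2 /\ ~ crossing c1 c2.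

(* Main.v *)
Require Import Defs.
From mathcomp Require Import all_boot all_order all_algebra.
From mathcomp Require Import zify.

Import GRing.Theory Num.Theory.

Set Implicit Arguments.
Unset Strict Implicit.
Unset Printing Implicit Defensive.

(** The inner cycle is a shortest cycle C of a well chosen subgraph, and the outer
    cycle replaces every edge of C by a detour outside C. It then visits the
    vertices of C in the order of C, so an edge of C joins vertices that are
    consecutive for this order (or the first and the last one) and no two edges of
    C cross; see [outer_cycle]. Everything comes down to finding disjoint detours,
    that is, to linking 2 k prescribed terminals in pairs, where k is the length
    of C. Here k is unbounded while the degrees are only bounded below by a
    constant q, so connectivity of a fixed order is not enough.

    The subgraph, of vertex set U, is extremal for a density condition with a
    logarithmic correction ([extremal_subgraph]). Its degrees exceed q, and
    twice the order of a proper separation is at least q plus the logarithm of the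
    smaller side.

    The girth k compensates for the weakness of this expansion, because every ball
    whose radius is a small fraction of k spans a tree and so has a number of
    vertices exponential in k, with q governing the base ([short_paths_eq],
    [ball_growth]). First, contracting such balls gives a graph of density
    exponential in k, hence a clique minor with 5 k branch sets, each of size
    exponential in k ([girth_clique_model], [dense_clique_model]). Secondly, the
    balls around the neighbours of C outside C are disjoint, so that a small
    set of vertices cannot block the way out of C ([free_leg]).

    Now split every vertex of C into two copies, the start of one detour and the
    end of another, and drop the edges within C. Suppose that fewer than 2 k
    vertices separate the copies from a branch set that avoids C. Adding C gives a
    separation of U of order less than 3 k with two sides of size exponential in
    k, against the choice of U; if k is small compared with q, the term q alone
    gives the contradiction ([doubled_separation]). This is the hypothesis of the
    linking theorem of Robertson and Seymour ([linking], which rests on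
    [menger]), and the linkage that it provides yields the detours
    ([detours]). *)

(** * Connected sets, separations and contractions *)

(** Vertex subsets stand for induced subgraphs throughout: the carrier type stays
    fixed, so that deleting and contracting need no change of type. *)
Definition induced (T : finType) (e : rel T) (V : {set T}) : rel T :=
  [rel x y | [&& x \in V, y \in V & e x y]].

Definition conn (T : finType) (e : rel T) (L : {set T}) : Prop :=
  forall x y, x \in L -> y \in L -> connect (induced e L) x y.

(** The order of the separation is #|X :&: Y|. *)
Definition separation (T : finType) (e : rel T) (V X Y : {set T}) : bool :=
  (X :|: Y == V) && [forall x in X :\: Y, forall y in Y :\: X, ~~ e x y].

(** The edge uv is contracted onto u; the vertex v keeps its edges, so the
    contracted graph lives on V :\ v. *)
Definition contract (T : finType) (e : rel T) (u v : T) : rel T :=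
  [rel x y | (x != y) && [|| e x y, (x == u) && e v y | (y == u) && e x v]].

Definition add_clique (T : finType) (e : rel T) (Z : {set T}) : rel T :=
  [rel x y | e x y || (x \in Z) && (y \in Z)].

Lemma induced_sym (T : finType) (e : rel T) V :
  symmetric e -> symmetric (induced e V).
Proof. by move=> se x y; rewrite /induced /= se andbCA. Qed.

Lemma contract_sym (T : finType) (e : rel T) u v :
  symmetric e -> symmetric (contract e u v).
Proof.
move=> se x y; rewrite /contract /= eq_sym se [e v y]se [e x v]se; congr (_ && _).
by rewrite [X in _ || X]orbC.
Qed.

Lemma add_clique_sym (T : finType) (e : rel T) Z :
  symmetric e -> symmetric (add_clique e Z).
Proof. by move=> se x y; rewrite /add_clique /= se [(x \in Z) && _]andbC. Qed.

(** Edges may be sent to whole walks, which covers contraction (an edge becomes a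
    point) and its inverse (an edge becomes a detour) at once. *)
Lemma connect_homo (T T' : finType) (r : rel T) (r' : rel T') (f : T -> T') :
  (forall x y, r x y -> connect r' (f x) (f y)) ->
  forall x y, connect r x y -> connect r' (f x) (f y).
Proof.
move=> H x y /connectP[p]; elim: p x => [|z p IH] x /=; first by move=> _ ->.
by case/andP=> /H xz /IH pz /pz; apply: connect_trans.
Qed.

Lemma conn_image (T T' : finType) (e : rel T) (e' : rel T') (f : T -> T')
    (L : {set T}) (L' : {set T'}) :
  (forall x y, x \in L -> y \in L -> e x y -> f x != f y -> e' (f x) (f y)) ->
  f @: L = L' -> conn e L -> conn e' L'.
Proof.
move=> He <- cL _ _ /imsetP[x xL ->] /imsetP[y yL ->].
apply: (@connect_homo _ _ (induced e L)); last exact: cL.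
move=> a b /and3P[aL bL ab]; case: (eqVneq (f a) (f b)) => [->|ne] //.
by apply: connect1; rewrite /induced /= !imset_f //= He.
Qed.

Lemma connect_induced_sub (T : finType) (e : rel T) (L M : {set T}) x y :
  L \subset M -> connect (induced e L) x y -> connect (induced e M) x y.
Proof.
move=> /subsetP LM; apply: (@connect_homo _ _ _ _ id) => a b /and3P[aL bL ab].
by apply: connect1; rewrite /induced /= !LM.
Qed.

Lemma conn1 (T : finType) (e : rel T) x : conn e [set x].
Proof. by move=> a b /set1P-> /set1P->. Qed.

Lemma conn_bigcup (T I : finType) (e : rel T) (P : pred I) (F : I -> {set T})
    (h : I -> T) :
  symmetric e -> (forall i, P i -> conn e (F i)) ->
  (forall i, P i -> h i \in F i) ->
  (forall i j, P i -> P j ->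
     connect (induced e (\bigcup_(i | P i) F i)) (h i) (h j)) ->
  conn e (\bigcup_(i | P i) F i).
Proof.
move=> se cF hF hh x y /bigcupP[i Pi xi] /bigcupP[j Pj yj].
have sub k : P k -> F k \subset \bigcup_(i | P i) F i by apply: bigcup_sup.
apply: connect_trans (connect_trans (hh i j Pi Pj) _).
  by apply: connect_induced_sub (sub i Pi) _; apply: cF => //; apply: hF.
by apply: connect_induced_sub (sub j Pj) _; apply: cF => //; apply: hF.
Qed.

Lemma connU (T : finType) (e : rel T) (L M : {set T}) a b :
  symmetric e -> conn e L -> conn e M -> a \in L -> b \in M ->
  a = b \/ e a b -> conn e (L :|: M).
Proof.
move=> se cL cM aL bM ab.
have sL x : x \in L -> connect (induced e (L :|: M)) x a.
  by move=> xL; apply: connect_induced_sub (subsetUl _ _) _; apply: cL.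
have sM x : x \in M -> connect (induced e (L :|: M)) x b.
  by move=> xM; apply: connect_induced_sub (subsetUr _ _) _; apply: cM.
have csym := sym_connect_sym (induced_sym (L :|: M) se).
have cab : connect (induced e (L :|: M)) a b.
  case: ab => [->//|ab]; apply: connect1.
  by rewrite /induced /= !inE aL bM ab orbT.
have sA x : x \in L :|: M -> connect (induced e (L :|: M)) x b.
  by case/setUP => [/sL H|/sM //]; apply: connect_trans H cab.
by move=> x y /sA xb /sA; rewrite csym; apply: connect_trans.
Qed.

Lemma separationP (T : finType) (e : rel T) (V X Y : {set T}) :
  reflect (X :|: Y = V /\
           forall x y, x \in X -> x \notin Y -> y \in Y -> y \notin X -> ~~ e x y)
          (separation e V X Y).
Proof.
apply: (iffP andP) => [[/eqP-> /forall_inP H]|[-> H]]; split=> //.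
  move=> x y xX xY yY yX; have := H x; rewrite inE xY xX => /(_ isT) /forall_inP.
  by apply; rewrite inE yX.
apply/forall_inP => x; rewrite inE => /andP[xY xX].
by apply/forall_inP => y; rewrite inE => /andP[yX yY]; apply: H.
Qed.

Lemma disjoint_notinP (T : finType) (A B : {set T}) :
  reflect (forall x, x \in A -> x \notin B) [disjoint A & B].
Proof.
by rewrite disjoint_subset; apply: (iffP subsetP) => H x /H; rewrite ?inE.
Qed.

(** Used to prolong a linkage across a separation: every F i hangs on G at h i. *)
Lemma conn_absorb (T I : finType) (e : rel T) (P : pred I) (F : I -> {set T})
    (h : I -> T) (G : {set T}) :
  symmetric e -> conn e G ->
  (forall i, P i -> [/\ conn e (F i), h i \in F i & h i \in G]) ->
  conn e (G :|: \bigcup_(i | P i) F i).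
Proof.
move=> se cG HF; set U := G :|: _.
have csym := sym_connect_sym (induced_sym U se).
have GU : G \subset U by apply: subsetUl.
have toG x : x \in U -> exists2 g, g \in G & connect (induced e U) x g.
  case/setUP=> [xG|/bigcupP[i Pi xF]]; first by exists x.
  have [cF hF hG] := HF i Pi; exists (h i) => //.
  apply: connect_induced_sub (cF _ _ xF hF).
  by apply: subset_trans (subsetUr _ _); apply: bigcup_sup.
move=> x y /toG[g gG xg] /toG[k kG yk].
rewrite csym in yk; apply: connect_trans xg (connect_trans _ yk).
exact: connect_induced_sub GU (cG _ _ gG kG).
Qed.

(** * Menger's theorem *)

(** Restoring deleted vertices on both sides keeps a separation; its order grows by
    at most their number. *)
Lemma separation_addW (T : finType) (e : rel T) (V W X Y : {set T}) :
  W \subset V ->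
  separation e (V :\: W) X Y -> separation e V (X :|: W) (Y :|: W).
Proof.
move=> WV /separationP[XY H]; apply/separationP; split.
  rewrite setUACA XY setUid; apply/setP=> z; rewrite !inE.
  by case zW: (z \in W); rewrite ?orbF // (subsetP WV).
move=> x y; rewrite !inE !negb_or.
case xW: (x \in W); rewrite ?orbT ?orbF ?andbF //= andbT => xX xY.
by case yW: (y \in W); rewrite ?orbT ?orbF ?andbF //= andbT; apply: H.
Qed.

(** A separation of one side that keeps the cut X :&: Y together extends to the
    whole graph with the same order. Hence both sides of a tight separation
    inherit the connectivity hypothesis, which is what the inductions on tight
    separations below rest on. *)
Lemma separation_restrictl (T : finType) (e : rel T) (V X Y P Q : {set T}) :
  separation e V X Y -> separation e X P Q -> X :&: Y \subset Q ->
  separation e V P (Q :|: Y) /\ P :&: (Q :|: Y) = P :&: Q.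
Proof.
move=> /separationP[VE sV] /separationP[XE sX] /subsetP sub.
split; last first.
  apply/setP=> z; rewrite !inE; case zP: (z \in P) => //=.
  case zY: (z \in Y); rewrite ?orbF // orbT; apply/esym/sub.
  by rewrite -XE !inE zP zY.
apply/separationP; rewrite setUA XE; split=> // x y xP.
rewrite !inE negb_or => /andP[xQ xY] yQY yP.
have xX : x \in X by rewrite -XE inE xP.
case yQ: (y \in Q); first by apply: sX; rewrite ?yQ.
move: yQY; rewrite yQ /= => yY; apply: sV => //; apply/negP => yX.
by move: (sub y); rewrite inE yX yY yQ => /(_ isT).
Qed.

Lemma separationC (T : finType) (e : rel T) (V X Y : {set T}) :
  symmetric e -> separation e V X Y = separation e V Y X.
Proof.
move=> se; apply/separationP/separationP => -[VE H].
  by rewrite setUC; split=> // x y xY xX yX yY; rewrite se; apply: H.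
by rewrite setUC; split=> // x y xY xX yX yY; rewrite se; apply: H.
Qed.

(** A family of disjoint paths from Z to Z', kept as connected sets: the set F z'
    joins z' in Z' to h z' in Z. Indexing by the target makes families compose
    along a cut. *)
Definition linked (T : finType) (e : rel T) (V Z Z' : {set T})
    (F : T -> {set T}) (h : T -> T) : Prop :=
  (forall z, z \in Z' ->
     [/\ conn e (F z), F z \subset V, z \in F z, h z \in F z & h z \in Z]) /\
  (forall z z' w, z \in Z' -> z' \in Z' -> w \in F z -> w \in F z' -> z = z').

Lemma linked_onto (T : finType) (e : rel T) (V Z Z' : {set T}) F h :
  linked e V Z Z' F h -> #|Z| = #|Z'| -> h @: Z' = Z.
Proof.
move=> [H1 H2] ZZ'; apply/eqP; rewrite eqEcard; apply/andP; split.
  by apply/subsetP=> _ /imsetP[z zZ ->]; case: (H1 z zZ).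
rewrite card_in_imset ?ZZ' // => z z' zZ zZ' hh.
case: (H1 z zZ) => _ _ _ h1 _; case: (H1 z' zZ') => _ _ _ h2 _.
by apply: (H2 z z' (h z)) => //; rewrite hh.
Qed.

(** The sets F1 and F2 live on different sides, so they can only meet in the cut,
    and each vertex s of the cut lies in F1 s and in no other set of that
    family. *)
Lemma linked_comp (T : finType) (e : rel T) (V X Y Z Z' : {set T}) F1 h1 F2 h2 :
  symmetric e -> X :|: Y = V ->
  linked e X Z (X :&: Y) F1 h1 -> linked e Y (X :&: Y) Z' F2 h2 ->
  linked e V Z Z' (fun z => F2 z :|: F1 (h2 z)) (h1 \o h2).
Proof.
move=> se VE [A1 A2] [B1 B2].
split=> [z zZ|z z' w zZ zZ'].
  have [c2 s2 z2 hz2 hS] := B1 z zZ; have [c1 s1 hz1 hh1 hZ] := A1 _ hS.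
  split=> //=; rewrite ?inE ?z2 ?hh1 ?orbT //.
    by apply: connU hz2 hz1 _ => //; left.
  by rewrite subUset -VE (subset_trans s2 (subsetUr _ _)) (subset_trans s1 (subsetUl _ _)).
have [_ _ _ hz2 hS] := B1 z zZ; have [_ _ _ hz2' hS'] := B1 z' zZ'.
have mid t t' : t \in Z' -> t' \in Z' -> w \in F2 t -> w \in F1 (h2 t') -> t = t'.
  move=> tZ tZ' w2 w1.
  have [_ s2t _ _ _] := B1 t tZ; have [_ _ _ ht' hSt'] := B1 t' tZ'.
  have [_ s1t' _ _ _] := A1 _ hSt'.
  have wS : w \in X :&: Y by rewrite inE (subsetP s2t) // (subsetP s1t').
  have [_ _ ww _ _] := A1 w wS.
  have E : w = h2 t' by apply: A2 ww w1.
  by apply: (B2 _ _ w) => //; rewrite E.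
case/setUP => w1 /setUP[] w2.
- exact: B2 w1 w2.
- exact: mid w1 w2.
- by apply/esym/mid.
have E : h2 z = h2 z' by apply: A2 w1 w2.
by apply: (B2 _ _ (h2 z)) => //; rewrite E.
Qed.

(** Menger's theorem for two sets of equal size, by induction on the number of
    vertices. A tight separation that is proper on both sides splits the problem
    in two. If there is none, every separation proper on both sides has order above
    #|Z|, which leaves room for deleting a vertex outside both sets, a vertex in
    both, or the two ends of an edge from Z to Z'. *)
Lemma menger (T : finType) (e : rel T) (se : symmetric e) (V Z Z' : {set T}) :
  Z \subset V -> Z' \subset V -> #|Z| = #|Z'| ->
  (forall X Y, separation e V X Y -> Z \subset X -> Z' \subset Y ->
     #|Z| <= #|X :&: Y|) ->
  exists F h, linked e V Z Z' F h.
Proof.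
have [n] := ubnP #|V|; elim: n V Z Z' => // n IH V Z Z' /ltnSE leV ZV ZV' ZZ' sep.
pose tight X Y := [&& separation e V X Y, Z \subset X, Z' \subset Y,
   #|X :&: Y| == #|Z|, X != V & Y != V].
case: (boolP [exists X, exists Y, tight X Y]) => [|notight].
  case/existsP=> X /existsP[Y /and5P[sXY ZX ZY /eqP cS /andP[XV YV]]].
  have [VE _] := separationP _ _ _ _ sXY.
  have ltX : #|X| < n.
    by apply: leq_trans leV; rewrite proper_card // properEneq XV -VE subsetUl.
  have ltY : #|Y| < n.
    by apply: leq_trans leV; rewrite proper_card // properEneq YV -VE subsetUr.
  have [||||F1 [h1 L1]] := IH X Z (X :&: Y) ltX; rewrite ?subsetIl //.
    move=> P Q sPQ ZP SQ; have [s1 s2] := separation_restrictl sXY sPQ SQ.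
    by rewrite -s2; apply: sep => //; apply: subset_trans ZY (subsetUr _ _).
  have [||||F2 [h2 L2]] := IH Y (X :&: Y) Z' ltY; rewrite ?subsetIr // ?cS //.
    move=> P Q sPQ SP ZQ.
    have sYX : separation e V Y X by rewrite separationC.
    have sQP : separation e Y Q P by rewrite separationC.
    rewrite setIC in SP.
    have [s1 s2] := separation_restrictl sYX sQP SP.
    rewrite [P :&: Q]setIC -s2 setIC; apply: sep => //; first by rewrite separationC.
    exact: subset_trans ZX (subsetUr _ _).
  by exists (fun z => F2 z :|: F1 (h2 z)), (h1 \o h2); apply: linked_comp L1 L2.
have {}tightN X Y : separation e V X Y -> Z \subset X -> Z' \subset Y ->
    X != V -> Y != V -> #|Z| < #|X :&: Y|.
  move=> s1 s2 s3 s4 s5; rewrite ltn_neqAle sep // andbT eq_sym; apply: contra notight => E.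
  by apply/existsP; exists X; apply/existsP; exists Y; apply/and5P; split=> //; apply/andP.
(* Removing W from all sets keeps the hypothesis as long as W has at most one
   vertex more than its trace on Z: adding W back to a separation that is too
   small would give a tight one. *)
have step (W : {set T}) : W \subset V -> W != set0 -> #|Z :&: W| = #|Z' :&: W| ->
    #|W| <= #|Z :&: W|.+1 -> exists F h, linked e (V :\: W) (Z :\: W) (Z' :\: W) F h.
  move=> WV W0 cW leW; apply: IH; rewrite ?setSD //.
  - apply: leq_trans leV; rewrite cardsD (setIidPr WV).
    by have := subset_leq_card WV; move: W0; rewrite -card_gt0; lia.
  - by rewrite !cardsD cW ZZ'.
  move=> X Y sXY ZX ZY; have [E _] := separationP _ _ _ _ sXY.
  have sW := separation_addW WV sXY.
  have cXY : #|(X :|: W) :&: (Y :|: W)| <= #|X :&: Y| + #|W|.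
    by rewrite -setUIl leq_card_setU.
  have XW : X \subset ~: W.
    apply/subsetP=> x xX; have : x \in V :\: W by rewrite -E inE xX.
    by rewrite !inE => /andP[].
  have YW : Y \subset ~: W.
    apply/subsetP=> x xX; have : x \in V :\: W by rewrite -E inE xX orbT.
    by rewrite !inE => /andP[].
  have sub (A B : {set T}) : A :\: W \subset B -> A \subset B :|: W.
    by rewrite setUC -subDset.
  have full (A B : {set T}) : A :|: B = V :\: W -> A \subset ~: W -> B :|: W = V -> A \subset B.
    move=> EA AW BV; apply/subsetP=> x xA; move: (subsetP AW _ xA); rewrite inE => xW.
    have: x \in V :\: W by rewrite -EA inE xA.
    rewrite inE -BV => /andP[_].
    by rewrite inE (negPf xW) orbF.
  case: (eqVneq (X :|: W) V) => [XWV|XWV].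
    have YX : Y \subset X by apply: full YW XWV; rewrite setUC.
    rewrite (setIidPr YX) cardsD cW ZZ' -cardsD; exact: subset_leq_card.
  case: (eqVneq (Y :|: W) V) => [YWV|YWV].
    have XY : X \subset Y by apply: full XW YWV.
    by rewrite (setIidPl XY); apply: subset_leq_card.
  have := tightN _ _ sW (sub _ _ ZX) (sub _ _ ZY) XWV YWV.
  rewrite cardsD; move: (subset_leq_card (subsetIl Z W)) leW cXY; clear; lia.
have extend z z' : z \in Z -> z' \in Z' -> z = z' \/ e z z' ->
    Z :&: [set z; z'] = [set z] -> Z' :&: [set z; z'] = [set z'] ->
    exists F h, linked e V Z Z' F h.
  move=> zZ zZ' ezz W1 W2.
  have WV : [set z; z'] \subset V by rewrite subUset !sub1set (subsetP ZV) // (subsetP ZV').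
  have [||||F [h [L1 L2]]] := step [set z; z'].
  - by [].
  - by apply/set0Pn; exists z; rewrite !inE eqxx.
  - by rewrite W1 W2 !cards1.
  - by rewrite W1 cards1 cards2; case: (_ != _).
  have cW : conn e [set z; z'].
    by apply: (connU se (@conn1 _ _ z) (@conn1 _ _ z') (set11 z) (set11 z')).
  have old t : t \in Z' -> t != z' -> t \in Z' :\: [set z; z'].
    move=> tZ tz; rewrite inE tZ andbT; apply/negP=> tW.
    have : t \in Z' :&: [set z; z'] by rewrite inE tZ.
    by rewrite W2 inE (negPf tz).
  have oldF t w : t \in Z' -> t != z' -> w \in F t -> w \notin [set z; z'].
    by move=> tZ tz wF; have [_ /subsetP/(_ _ wF)] := L1 t (old t tZ tz); rewrite inE => /andP[].
  exists (fun t => if t == z' then [set z; z'] else F t), (fun t => if t == z' then z else h t).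
  split=> [t tZ|t t' w tZ tZ'].
    case: eqVneq => [->|tz]; first by split=> //; rewrite !inE eqxx ?orbT.
    have [c s t1 t2] := L1 t (old t tZ tz); rewrite inE => /andP[_ hZ]; split=> //.
    by apply: subset_trans s (subsetDl _ _).
  case: eqVneq => [->|tz]; case: eqVneq => [->|tz'] // w1 w2.
  - by move: (oldF t' w tZ' tz' w2); rewrite w1.
  - by move: (oldF t w tZ tz w1); rewrite w2.
  by apply: (L2 _ _ w) => //; apply: old.
case: (boolP [exists v in V, v \notin Z :|: Z']) => [/exists_inP[v vV]|none].
  rewrite inE negb_or => /andP[vZ vZ'].
  have E (A : {set T}) : v \notin A -> A :&: [set v] = set0.
    by move=> vA; apply/setP=> x; rewrite !inE; case: eqP => [->|]; rewrite ?andbF // (negPf vA).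
  have D (A : {set T}) : v \notin A -> A :\: [set v] = A by move=> /E/eqP; rewrite setI_eq0 => /setDidPl.
  have [||||F [h [L1 L2]]] := step [set v].
  - by rewrite sub1set.
  - by apply/set0Pn; exists v; rewrite inE.
  - by rewrite !E.
  - by rewrite cards1.
  rewrite (D Z) // (D Z') // in L1 L2; exists F, h; split=> // t tZ.
  by have [c s t1 t2 t3] := L1 t tZ; split=> //; apply: subset_trans s (subsetDl _ _).
case: (boolP [exists v in Z, v \in Z']) => [/exists_inP[v vZ vZ']|dis].
  have E (A : {set T}) : v \in A -> A :&: [set v; v] = [set v].
    by move=> vA; apply/setP=> x; rewrite !inE orbb; case: eqP => [->|]; rewrite ?andbF // vA.
  by apply: (extend v v) => //; [left | rewrite E | rewrite E].
case: (eqVneq Z set0) => [Z0|Z0].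
  have Z0' : Z' = set0 by apply/eqP; rewrite -cards_eq0 -ZZ' Z0 cards0.
  by exists (fun z => [set z]), id; rewrite Z0'; split=> [z|z z' w]; rewrite in_set0.
have disj x : x \in Z -> x \in Z' = false.
  by move=> xZ; apply/negP=> xZ'; case/negP: dis; apply/exists_inP; exists x.
case: (boolP [exists z in Z, exists z' in Z', e z z']) => [|noe].
  case/exists_inP=> z zZ /exists_inP[z' zZ' ezz].
  have zz : z != z' by apply: contraFneq (disj z zZ) => ->.
  apply: (extend z z') => //; first by right.
    apply/setP=> x; rewrite !inE; case xZ: (x \in Z) => /=; last first.
      by apply/esym/negP=> /eqP E; rewrite E zZ in xZ.
    by case: (eqVneq x z') => [E|]; rewrite ?orbF //; move: zZ'; rewrite -E disj.
  apply/setP=> x; rewrite !inE; case xZ: (x \in Z') => /=; last first.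
    by apply/esym/negP=> /eqP E; rewrite E zZ' in xZ.
  by case: (eqVneq x z) => [E|] //; move: xZ; rewrite E disj.
suff : #|Z| <= #|Z :&: Z'|.
  have /eqP-> : Z :&: Z' == set0.
    by apply/eqP/setP=> x; rewrite !inE; case xZ: (x \in Z) => //=; rewrite disj.
  by rewrite cards0 leqn0 cards_eq0 (negPf Z0).
apply: sep => //; apply/separationP; split.
  apply/eqP; rewrite eqEsubset subUset ZV ZV' /=; apply/subsetP=> x xV.
  by apply: contraR none => xZ; apply/exists_inP; exists x.
move=> x y xZ _ yZ _; apply: contra noe => exy; apply/exists_inP; exists x => //.
by apply/exists_inP; exists y.
Qed.

(** * Clique minors *)

(** A clique minor: disjoint connected branch sets, pairwise joined by an edge. *)
Definition clique_model (T : finType) (I : eqType) (e : rel T) (V : {set T})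
    (A : I -> {set T}) (J : {pred I}) : Prop :=
  [/\ forall i, i \in J -> [/\ A i \subset V, A i != set0 & conn e (A i)],
      forall i j x, i \in J -> j \in J -> x \in A i -> x \in A j -> i = j &
      forall i j, i \in J -> j \in J -> i != j ->
        exists x y, [/\ x \in A i, y \in A j & e x y]].

(** The preimage under the contraction of uv onto u of a set avoiding v. *)
Definition expand (T : finType) (u v : T) (L : {set T}) : {set T} :=
  if u \in L then v |: L else L.

Lemma in_expand (T : finType) (u v x : T) (L : {set T}) :
  (x \in expand u v L) = (x \in L) || (x == v) && (u \in L).
Proof. by rewrite /expand; case: ifP; rewrite ?andbF ?orbF ?andbT // !inE orbC. Qed.

Lemma conn_expand (T : finType) (e : rel T) (u v : T) (L : {set T}) :
  symmetric e -> e u v -> v \notin L -> conn (contract e u v) L ->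
  conn e (expand u v L).
Proof.
move=> se uv vL cL.
have csym := sym_connect_sym (induced_sym (expand u v L) se).
have vx x : x \in expand u v L -> u \in L -> e v x -> connect (induced e (expand u v L)) v x.
  by move=> xL uL vxe; apply: connect1; rewrite /induced /= xL vxe in_expand eqxx uL orbT.
have inL x : x \in L -> x \in expand u v L by rewrite in_expand => ->.
have uvc : u \in L -> connect (induced e (expand u v L)) u v.
  by move=> uL; rewrite csym; apply: vx; rewrite ?inL // se.
have sub x y : x \in L -> y \in L -> connect (induced e (expand u v L)) x y.
  move=> xL yL; apply: (@connect_homo _ _ (induced (contract e u v) L) _ id); last exact: cL.
  move=> a b /and3P[aL bL /andP[_ /or3P[ab|/andP[/eqP E vb]|/andP[/eqP E av]]]].
  - by apply: connect1; rewrite /induced /= !inL.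
  - have uL : u \in L by rewrite -E.
    by rewrite E; apply: connect_trans (uvc uL) (vx _ (inL _ bL) uL vb).
  have uL : u \in L by rewrite -E.
  rewrite E csym; apply: connect_trans (uvc uL) (vx _ (inL _ aL) uL _).
  by rewrite se.
have subv x : x \in L -> u \in L -> connect (induced e (expand u v L)) x v.
  by move=> xL uL; apply: connect_trans (sub _ _ xL uL) (uvc uL).
move=> x y; rewrite !in_expand => /orP[xL|/andP[/eqP-> uL]] /orP[yL|/andP[/eqP-> uL']] //.
- exact: sub.
- exact: subv.
- by rewrite csym; apply: subv.
Qed.

Lemma conn_contract (T : finType) (e e' : rel T) (u v : T) (L : {set T}) :
  (forall x y, contract e u v x y -> e' x y) ->
  (v \in L -> u \in L) -> u != v -> symmetric e -> conn e L -> conn e' (L :\ v).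
Proof.
move=> ee' vu uv se; apply: (@conn_image _ _ _ _ (fun x => if x == v then u else x)).
  move=> x y xL yL xy ne; apply: ee'; rewrite /contract /= ne /=.
  case: (eqVneq x v) ne => [Ex|xv]; case: (eqVneq y v) => [Ey|yv] ne.
  - by rewrite eqxx in ne.
  - by rewrite -Ex xy eqxx orbT.
  - by rewrite -Ey xy eqxx !orbT.
  - by rewrite xy.
apply/setP=> x; apply/imsetP/idP => [[y yL ->]|].
  by rewrite !inE; case: (eqVneq y v) => [E|->]; rewrite ?yL ?uv // vu // -E.
by rewrite !inE => /andP[xv xL]; exists x; rewrite // (negPf xv).
Qed.

Lemma contract_model (T : finType) (I : eqType) (e e' : rel T) (V : {set T})
    (A : I -> {set T}) (J : {pred I}) (u v : T) (i0 : I) :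
  symmetric e -> u != v -> i0 \in J -> u \in A i0 -> v \in A i0 ->
  (forall x y, contract e u v x y -> e' x y) ->
  clique_model e V A J -> clique_model e' (V :\ v) (fun i => A i :\ v) J.
Proof.
move=> se uv i0J uA vA ee' [M1 M2 M3].
have vu i : i \in J -> v \in A i -> u \in A i.
  by move=> iJ vi; rewrite -(M2 _ _ _ i0J iJ vA vi).
split=> [i iJ|i j x iJ jJ|i j iJ jJ ij].
- have [s n c] := M1 i iJ; split; first exact: setSD.
    apply/set0Pn; case/set0Pn: n => x xA; case: (eqVneq x v) => [E|xv].
      by exists u; rewrite !inE uv vu -?E.
    by exists x; rewrite !inE xv.
  exact: conn_contract ee' (vu i iJ) uv se c.
- by rewrite !inE => /andP[_ xi] /andP[_ xj]; apply: M2 xi xj.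
have [x [y [xi yj xy]]] := M3 i j iJ jJ ij.
have nev : (x == v) && (y == v) = false.
  apply/negP=> /andP[/eqP Ex /eqP Ey]; rewrite Ex in xi; rewrite Ey in yj.
  by move: ij; rewrite (M2 _ _ _ iJ jJ xi yj) eqxx.
pose f z := if z == v then u else z.
have fi z k : k \in J -> z \in A k -> f z \in A k :\ v.
  by move=> kJ zk; rewrite /f !inE; case: (eqVneq z v) => [E|->]; rewrite ?uv ?zk // vu // -E.
exists (f x), (f y); rewrite !fi //; split=> //; apply: ee'.
have ne : f x != f y.
  apply/negP=> /eqP E; move: (fi _ _ iJ xi) (fi _ _ jJ yj); rewrite -E !inE.
  by move=> /andP[_ a] /andP[_ b]; move: ij; rewrite (M2 _ _ _ iJ jJ a b) eqxx.
rewrite /contract /= ne /= /f; move: nev.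
case: (eqVneq x v) => [Ex|xv]; case: (eqVneq y v) => [Ey|yv] //= _.
- by rewrite -Ex xy eqxx orbT.
- by rewrite -Ey xy eqxx !orbT.
- by rewrite xy.
Qed.

(** Each set of a disjoint family that meets Z owns a vertex of Z. *)
Lemma card_meeting (T I : finType) (A : I -> {set T}) (J : {set I}) (Z : {set T}) :
  (forall i j x, i \in J -> j \in J -> x \in A i -> x \in A j -> i = j) ->
  #|[set i in J | ~~ [disjoint A i & Z]]| <= #|Z|.
Proof.
move=> dA; pose f i := [pick x in A i :&: Z].
have fP i : i \in [set i in J | ~~ [disjoint A i & Z]] ->
    exists2 x, x \in A i :&: Z & f i = Some x.
  rewrite inE => /andP[_ iZ]; rewrite /f; case: pickP => [x xA|no]; first by exists x.
  case/negP: iZ; apply/disjoint_notinP=> x xA; apply/negP=> xZ.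
  by move: (no x); rewrite /= inE xA xZ.
rewrite -(card_in_imset (f := f)); last first.
  move=> i j iJ jJ; have [x] := fP i iJ; have [y] := fP j jJ.
  rewrite !inE => /andP[yA _] -> /andP[xA _] -> [E]; rewrite -E in yA.
  by move: iJ jJ; rewrite !inE => /andP[iJ _] /andP[jJ _]; apply: (dA _ _ _ iJ jJ xA yA).
have -> : #|Z| = #|Some @: Z| by rewrite card_imset //; apply: Some_inj.
apply: subset_leq_card; apply/subsetP=> _ /imsetP[i iJ ->]; have [x xA ->] := fP i iJ.
by apply: imset_f; move: xA; rewrite inE => /andP[].
Qed.

(** * The linking theorem *)

Lemma contract_add_clique (T : finType) (e : rel T) (Z : {set T}) (u v x y : T) :
  v \notin Z -> contract (add_clique e Z) u v x y -> add_clique (contract e u v) Z x y.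
Proof.
rewrite /contract /add_clique /= => vZ /andP[-> /=]; rewrite (negPf vZ) andbF !orbF.
by case/or3P => [/orP[]|/andP[-> ->]|/andP[-> ->]]; rewrite ?orbT // => ->; rewrite ?orbT.
Qed.

(** When a separation cuts Z off from one branch set, the model survives on the
    side Y with the cut as new terminal set. Pieces that a branch set loses
    beyond the cut are replaced by the clique on the cut, and every branch set
    reaches Y because it is adjacent to the one that lies entirely there. *)
Lemma restrict_model (T : finType) (I : eqType) (e : rel T) (V X Y Z : {set T})
    (A : I -> {set T}) (J : {pred I}) (i0 : I) :
  symmetric e -> separation e V X Y -> Z \subset X -> i0 \in J -> [disjoint A i0 & X] ->
  clique_model (add_clique e Z) V A J ->
  clique_model (add_clique e (X :&: Y)) Y (fun i => A i :&: Y) J /\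
  (forall i, i \in J -> [disjoint A i & X :&: Y] -> [disjoint A i & X]).
Proof.
move=> se /separationP[VE sXY] ZX i0J dis [M1 M2 M3].
pose e1 := add_clique e Z; pose e2 := add_clique e (X :&: Y).
have AV i x : i \in J -> x \in A i -> (x \in X) || (x \in Y).
  by move=> iJ xA; case: (M1 i iJ) => /subsetP/(_ x xA); rewrite -VE inE.
have ZXx x : x \in Z -> x \in X by apply: (subsetP ZX).
have cross x y : x \in Y -> (y \in X) || (y \in Y) -> y \notin Y -> e1 x y -> x \in X.
  move=> xY; case yY: (y \in Y); rewrite ?orbF // => yX _ /orP[xy|/andP[/ZXx]//].
  by apply: contraT => xX; move: (sXY y x yX); rewrite yY xY se xy => /(_ isT isT xX).
have meetY i : i \in J -> exists2 x, x \in A i & x \in Y.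
  move=> iJ; case: (eqVneq i i0) => [->|ne].
    case: (M1 i0 i0J) => s /set0Pn[x xA] _; exists x => //.
    by move: (AV _ _ i0J xA); rewrite (disjointFr dis xA).
  have [x [y [xA yA xy]]] := M3 i i0 iJ i0J ne; exists x => //.
  have yX : y \in X = false by rewrite (disjointFr dis yA).
  have yY : y \in Y by move: (AV _ _ i0J yA); rewrite yX.
  have exy : e x y by case/orP: xy => // /andP[_ /ZXx]; rewrite yX.
  apply: contraT => xY; have xX : x \in X by move: (AV _ _ iJ xA); rewrite (negPf xY) orbF.
  by move: (sXY x y xX xY yY); rewrite yX exy => /(_ isT).
(* Walking inside A i from a vertex of Y: an excursion out of Y begins and ends
   in X :&: Y, where the clique replaces it. *)
have reach i x y : i \in J -> x \in A i -> x \in Y -> connect (induced e1 (A i)) x y ->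
    y \in A i /\
    if y \in Y then is_true (connect (induced e2 (A i :&: Y)) x y)
    else exists2 s, s \in A i :&: (X :&: Y) & connect (induced e2 (A i :&: Y)) x s.
  move=> iJ xA xY /connectP[p + ->]; elim/last_ind: p => [|p z IH] /=; first by rewrite xY.
  rewrite rcons_path last_rcons => /andP[/IH{IH}].
  set w := last x p => -[wA wP] /and3P[_ zA wz]; split=> //; move: wP.
  case wY: (w \in Y); case zY: (z \in Y) => wP.
  - apply: connect_trans wP (connect1 _); rewrite /e2 /add_clique /induced /= !inE wA zA wY zY /=.
    by case/orP: wz => [->//|/andP[/ZXx wX /ZXx zX]]; rewrite wX zX orbT.
  - exists w => //; rewrite !inE wA wY andbT; apply: (cross w z) => //; last by rewrite zY.
    exact: AV iJ zA.
  - case: wP => s; rewrite !inE => /andP[sA /andP[sX sY]] sc.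
    apply: connect_trans sc (connect1 _); rewrite /e2 /add_clique /induced /= !inE sA zA sX sY zY /=.
    have zX : z \in X.
      apply: (cross z w) => //; first exact: AV iJ wA.
        by rewrite wY.
      by rewrite /e1 add_clique_sym.
    by rewrite zX orbT.
  - exact: wP.
have meetS i x : i \in J -> x \in A i -> x \in X -> exists2 s, s \in A i & s \in X :&: Y.
  move=> iJ xA xX; case xY: (x \in Y); first by exists x; rewrite ?inE ?xX.
  have [y yA yY] := meetY i iJ; have [_ _ c] := M1 i iJ.
  have [_] := reach i y x iJ yA yY (c _ _ yA xA); rewrite xY => -[s].
  by rewrite inE => /andP[]; exists s.
split; last first.
  move=> i iJ dS; rewrite disjoint_subset; apply/subsetP=> x xA; apply/negP=> xX.
  by have [s sA sS] := meetS i x iJ xA xX; rewrite (disjointFr dS sA) in sS.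
split=> [i iJ|i j x iJ jJ|i j iJ jJ ij].
- have [s n c] := M1 i iJ; split; first exact: subsetIr.
    by have [x xA xY] := meetY i iJ; apply/set0Pn; exists x; rewrite inE xA.
  move=> x y; rewrite !inE => /andP[xA xY] /andP[yA yY].
  by have [_] := reach i x y iJ xA xY (c _ _ xA yA); rewrite yY.
- by rewrite !inE => /andP[xi _] /andP[xj _]; apply: M2 xi xj.
have [x [y [xA yA xy]]] := M3 i j iJ jJ ij.
have bothS : (exists2 s, s \in A i & s \in X :&: Y) -> (exists2 s, s \in A j & s \in X :&: Y) ->
    exists x0 y0 : T, [/\ x0 \in A i :&: Y, y0 \in A j :&: Y & e2 x0 y0].
  move=> [s sA sS] [t tA tS]; exists s, t; rewrite !inE sA tA /e2 /add_clique /= sS tS orbT.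
  by move: sS tS; rewrite !inE => /andP[_ ->] /andP[_ ->].
have yx : e1 y x by rewrite /e1 add_clique_sym.
case xY: (x \in Y); last first.
  have xX : x \in X by move: (AV _ _ iJ xA); rewrite xY orbF.
  apply: bothS; first exact: meetS xA xX.
  case yY: (y \in Y); last by apply: (meetS j y); move: (AV _ _ jJ yA); rewrite yY orbF.
  exists y; rewrite ?inE ?yY ?andbT //; apply: cross yx; rewrite ?xX ?xY //.
case yY: (y \in Y); last first.
  have yX : y \in X by move: (AV _ _ jJ yA); rewrite yY orbF.
  apply: bothS; last exact: meetS yA yX.
  exists x; rewrite ?inE ?xY ?andbT //; apply: cross xy; rewrite ?yX ?yY //.
exists x, y; rewrite !inE xA yA xY yY; split=> //.
by case/orP: xy => [xy|/andP[/ZXx xX /ZXx yX]]; rewrite /e2 /add_clique /= ?xy // !inE xX xY yX yY orbT.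
Qed.

(** A separation of the contracted graph lifts; its order increases only if both
    ends of the contracted edge land in the cut. *)
Lemma separation_expand (T : finType) (e : rel T) (u v : T) (V X Y : {set T}) :
  symmetric e -> u != v -> u \in V -> v \in V ->
  separation (contract e u v) (V :\ v) X Y ->
  separation e V (expand u v X) (expand u v Y).
Proof.
move=> se uv uV vV /separationP[VE sXY].
have uXY : (u \in X) || (u \in Y).
  by rewrite -in_setU VE !inE uv uV.
apply/separationP; split.
  apply/setP=> x; rewrite inE !in_expand -orbACA -in_setU VE -andb_orr uXY andbT !inE.
  by case: (eqVneq x v) => [->|_]; rewrite ?orbF //= vV.
have main x y : x \in expand u v X -> x \notin expand u v Y -> y \in Y -> y \notin expand u v X ->
    ~~ e x y.
  rewrite !in_expand !negb_or => /orP[xX|/andP[/eqP-> uX]] /andP[xY xY'] yY /andP[yX yX'].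
    by move: (sXY x y xX xY yY yX); rewrite /contract /= !negb_and negbK negb_or => /orP[/eqP E|/andP[]//]; rewrite -E xX in yX.
  have uY : u \notin Y by move: xY'; rewrite eqxx.
  have uy : u != y by apply: contraNneq uY => ->.
  by move: (sXY u y uX uY yY yX); rewrite /contract /= uy eqxx !negb_or => /and3P[].
move=> x y xX xY; rewrite in_expand => /orP[yY yX|/andP[/eqP-> uY] vX]; first exact: main.
have uX : u \notin X by move: vX; rewrite in_expand eqxx /= negb_or => /andP[].
move: xX xY; rewrite !in_expand (negPf uX) andbF orbF !negb_or => xX /andP[xY _].
have xu : x != u by apply: contraNneq uX => <-.
by move: (sXY x u xX xY uY uX); rewrite /contract /= xu eqxx !negb_or => /and3P[].
Qed.

Lemma conn_edge (T : finType) (e : rel T) (A : {set T}) a b :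
  conn e A -> a \in A -> b \in A -> a != b ->
  exists x y, [/\ x \in A, y \in A, x != y & e x y].
Proof.
move=> cA aA bA ab; have /connectP[p] := cA a b aA bA.
elim: p a aA ab => [|x p IH] a aA ab /=; first by move=> _ E; rewrite E eqxx in ab.
case/andP=> /and3P[_ xA ax]; case: (eqVneq a x) => [<-|ne]; first exact: IH.
by exists a, x.
Qed.

(** Robertson and Seymour's linking theorem, for arbitrary partitions of the
    terminals (the fibres of c). Making Z a clique in the model hypothesis allows
    a branch set to be disconnected or non-adjacent to another one as long as the
    defect can be repaired inside Z; this is the form that passes through the
    induction on the number of vertices.
    If a tight separation with Y != V cuts Z off from a branch set, Menger's
    theorem carries the terminals to the cut and the induction continues in Y.
    Otherwise an edge inside a branch set avoiding Z can be contracted: a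
    separation that becomes too small would lift to a tight one whose cut
    contains the edge. When nothing is left to contract, at least #|Z| branch
    sets are single vertices, they form a clique, and Menger's theorem carries
    the terminals to them. *)
Lemma linking (T : finType) (I : finType) (L : eqType) (e : rel T) (V Z : {set T})
    (A : I -> {set T}) (J : {set I}) (c : T -> L) :
  symmetric e -> Z \subset V -> 2 * #|Z| <= #|J| ->
  clique_model (add_clique e Z) V A (mem J) ->
  (forall i X Y, i \in J -> separation e V X Y -> Z \subset X ->
     [disjoint A i & X] -> #|Z| <= #|X :&: Y|) ->
  exists F : L -> {set T},
    [/\ forall l, conn e (F l) /\ F l \subset V,
        forall z, z \in Z -> z \in F (c z) &
        forall l l' w, w \in F l -> w \in F l' -> l = l'].
Proof.
have [n] := ubnP #|V|; elim: n e V Z A c => // n IH e V Z A c /ltnSE leV se ZV ZJ M sep.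
(* Condition Y != V excludes the cut X = Z, which is always there. *)
pose tight X Y i := [&& separation e V X Y, Z \subset X, [disjoint A i & X],
   #|X :&: Y| == #|Z| & Y != V].
case: (boolP [exists i in J, exists X, exists Y, tight X Y i]) => [|notight].
  case/exists_inP=> i0 i0J /existsP[X /existsP[Y /and5P[sXY ZX dX /eqP cS YV]]].
  have [VE _] := separationP _ _ _ _ sXY.
  have [M' meet] := restrict_model se sXY ZX i0J dX M.
  have [F [h L1]] : exists F h, linked e X Z (X :&: Y) F h.
    apply: menger; rewrite ?subsetIl //.
    move=> P Q sPQ ZP SQ; have [s1 s2] := separation_restrictl sXY sPQ SQ.
    rewrite -s2; apply: (sep i0) => //.
    apply: disjointWr dX; have [<- _] := separationP _ _ _ _ sPQ; exact: subsetUl.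
  have ltY : #|Y| < n.
    by apply: leq_trans leV; rewrite proper_card // properEneq YV -VE subsetUr.
  have [||||G [G1 G2 G3]] := IH e Y (X :&: Y) (fun i => A i :&: Y) (c \o h) ltY se; rewrite ?subsetIr ?cS //.
    move=> i P Q iJ sPQ SP dP.
    have sYX : separation e V Y X by rewrite separationC.
    have sQP : separation e Y Q P by rewrite separationC.
    have [s1 s2] : separation e V Q (P :|: X) /\ Q :&: (P :|: X) = Q :&: P.
      by apply: separation_restrictl sYX sQP _; rewrite setIC.
    rewrite [P :&: Q]setIC -s2 setIC; apply: (sep i) => //; first by rewrite separationC.
      exact: subset_trans ZX (subsetUr _ _).
    have PY : P \subset Y by have [<- _] := separationP _ _ _ _ sPQ; apply: subsetUl.
    move/disjoint_notinP: dP => dP.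
    have dAX : [disjoint A i & X].
      apply: meet => //; apply/disjoint_notinP => x xA; apply/negP => xS.
      move: (dP x); rewrite (subsetP SP) // inE xA.
      by move: xS; rewrite !inE => /andP[_ ->] /(_ isT).
    apply/disjoint_notinP => x xA; rewrite inE negb_or (disjointFr dAX xA) andbT.
    by apply/negP => xP; move: (dP x); rewrite inE xA (subsetP PY) // xP => /(_ isT).
  have [L1a L1b] := L1.
  have onto := linked_onto L1 (esym cS).
  exists (fun l => G l :|: \bigcup_(s in X :&: Y | c (h s) == l) F s); split=> [l|z zZ|l l' w].
  - have [cG sG] := G1 l; split.
      apply: conn_absorb (id) _ se cG _ => s /andP[sS /eqP <-].
      have [cF _ sF _ _] := L1a s sS; split=> //.
      exact: (G2 s).
    rewrite subUset -VE (subset_trans sG (subsetUr _ _)) /=.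
    apply/bigcupsP=> s /andP[sS _]; have [_ sF _ _ _] := L1a s sS.
    exact: subset_trans sF (subsetUl _ _).
  - move: zZ; rewrite -onto => /imsetP[s sS ->]; rewrite inE; apply/orP; right.
    by apply/bigcupP; exists s; rewrite ?sS ?eqxx //; have [] := L1a s sS.
  have mid l1 l2 : w \in G l1 -> w \in \bigcup_(s in X :&: Y | c (h s) == l2) F s -> l1 = l2.
    move=> wG /bigcupP[s /andP[sS /eqP<-] wF]; have [_ /subsetP/(_ w wF) wX _ _ _] := L1a s sS.
    have wY : w \in Y by have [_ /subsetP/(_ w wG)] := G1 l1.
    have wS : w \in X :&: Y by rewrite inE wX.
    have [_ _ ww _ _] := L1a w wS.
    have E := L1b _ _ _ wS sS ww wF; apply: (G3 _ _ w wG).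
    by rewrite -E; apply: (G2 w).
  case/setUP=> w1 /setUP[] w2; [exact: G3 w1 w2|exact: mid w1 w2|by apply/esym/mid|].
  case/bigcupP: w1 => s /andP[sS /eqP<-] w1; case/bigcupP: w2 => s' /andP[sS' /eqP<-] w2.
  by rewrite (L1b _ _ _ sS sS' w1 w2).
have {}notight X Y i : i \in J -> separation e V X Y -> Z \subset X -> [disjoint A i & X] ->
    Y != V -> #|Z| < #|X :&: Y|.
  move=> iJ sXY ZX dX YV; rewrite ltn_neqAle (sep i) // andbT eq_sym.
  apply: contra notight => E; apply/exists_inP; exists i => //; apply/existsP; exists X.
  by apply/existsP; exists Y; apply/and5P.
have [M1 M2 M3] := M.
case: (boolP [exists i in J, [disjoint A i & Z] && (1 < #|A i|)]) => [|single].
  case/exists_inP=> i0 i0J /andP[dZ /card_gt1P[a [b [aA bA ab]]]].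
  have [sA _ cA] := M1 i0 i0J.
  have [u [v [uA vA uv euv]]] := conn_edge cA aA bA ab.
  have vZ : v \notin Z by rewrite (disjointFr dZ vA).
  have uZ : u \notin Z by rewrite (disjointFr dZ uA).
  have {}euv : e u v by move: euv; rewrite /add_clique /= (negPf uZ) orbF.
  have uV := subsetP sA u uA; have vV := subsetP sA v vA.
  have ltV : #|V :\ v| < n by apply: leq_trans leV; rewrite [leqRHS](cardsD1 v) vV.
  have ZV1 : Z \subset V :\ v.
    apply/subsetP=> z zZ; rewrite !inE (subsetP ZV) // andbT.
    by apply: contraNneq vZ => <-.
  have M' := contract_model (add_clique_sym Z se) uv i0J uA vA
    (fun x y => @contract_add_clique _ e Z u v x y vZ) M.
  have [|F [F1 F2 F3]] := IH (contract e u v) (V :\ v) Z (fun i => A i :\ v) c ltV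
     (contract_sym u v se) ZV1 ZJ M'.
    move=> i X Y iJ sXY ZX dX; rewrite leqNgt; apply/negP=> lt.
    have sE := separation_expand se uv uV vV sXY.
    have ZE : Z \subset expand u v X.
      by apply/subsetP=> z zZ; rewrite in_expand (subsetP ZX).
    have dE : [disjoint A i & expand u v X].
      apply/disjoint_notinP => x xA; rewrite in_expand negb_or.
      case: (eqVneq x v) => [E|xv] /=.
        have Ei : i0 = i by apply: (M2 _ _ v) => //; rewrite -E.
        have uX : u \notin X by rewrite (disjointFr dX) // !inE uv -Ei.
        have vX : v \notin X.
          have [VE _] := separationP _ _ _ _ sXY; apply/negP=> vX.
          have : v \in V :\ v by rewrite -VE inE vX.
          by rewrite !inE eqxx.
        by rewrite E uX vX.
      by rewrite (disjointFr dX) // !inE xv.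
    have cE : #|expand u v X :&: expand u v Y| <= #|v |: X :&: Y|.
      apply: subset_leq_card; apply/subsetP=> x; rewrite !inE !in_expand.
      by case: (x == v); rewrite //= !orbF.
    have cE' : #|v |: X :&: Y| <= (#|X :&: Y|).+1 by rewrite cardsU1; case: (_ \notin _).
    case: (boolP (u \in X :&: Y)) => [uXY|uXY].
      have YV : expand u v Y != V.
        have [VE _] := separationP _ _ _ _ sXY.
        have XV : X \subset V :\ v by rewrite -VE subsetUl.
        apply/negP=> /eqP E; suff XY : X \subset Y.
          by have := subset_leq_card ZX; rewrite (setIidPl XY) in lt; rewrite leqNgt lt.
        apply/subsetP=> x /(subsetP XV); rewrite !inE -E in_expand => /andP[xv].
        by rewrite (negPf xv) orbF.
      have lt' := leq_trans (notight _ _ i iJ sE ZE dE YV) (leq_trans cE cE').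
      by rewrite ltnS leqNgt lt in lt'.
    have := sep i _ _ iJ sE ZE dE; rewrite leqNgt => /negP[].
    apply: leq_ltn_trans lt; apply: subset_leq_card; apply/subsetP=> x.
    rewrite inE !in_expand !inE; case: (eqVneq x v) => [->|_] /=; rewrite ?orbF //.
    rewrite -in_setI; case/andP=> vX vY.
    have [VE _] := separationP _ _ _ _ sXY.
    have : v \notin X :|: Y by rewrite VE !inE eqxx.
    rewrite inE negb_or => /andP[/negPf vX' /negPf vY']; rewrite vX' vY' /= in vX vY.
    by move: uXY; rewrite inE vX vY.
  have vF l : v \notin F l.
    by have [_ /subsetP s] := F1 l; apply/negP=> /s; rewrite !inE eqxx.
  exists (fun l => expand u v (F l)); split=> [l|z zZ|l l' w].
  - have [cF sF] := F1 l; split; first exact: conn_expand.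
    apply/subsetP=> x; rewrite in_expand => /orP[/(subsetP sF)|/andP[/eqP->//]].
    by rewrite !inE => /andP[].
  - by rewrite in_expand F2.
  rewrite !in_expand; case: (eqVneq w v) => [->|_] /=; last by rewrite !orbF; apply: F3.
  by rewrite !(negPf (vF _)) /=; apply: F3.
case: (eqVneq Z set0) => [Z0|/set0Pn[t0 t0Z]].
  exists (fun=> set0); split=> [l|z|l l' w]; rewrite ?Z0 ?inE //.
  by split; [move=> x y; rewrite inE | rewrite sub0set].
pose J1 := [set i in J | [disjoint A i & Z]].
(* At most #|Z| branch sets meet Z; this is why J has twice as many. *)
have cJ1 : #|Z| <= #|J1|.
  have: #|J :\: J1| <= #|Z|.
    apply: leq_trans (card_meeting Z M2); apply: subset_leq_card.
    by apply/subsetP=> i; rewrite !inE; case: (i \in J); rewrite /= ?andbT.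
  have: J1 \subset J by apply/subsetP=> i; rewrite inE => /andP[].
  move=> /setIidPr E; rewrite cardsD E; lia.
have [J2 J21 cJ2] : exists2 J2 : {set I}, J2 \subset J1 & #|J2| = #|Z|.
  exists [set i in take #|Z| (enum J1)].
    by apply/subsetP=> i; rewrite inE => /mem_take; rewrite mem_enum.
  rewrite cardsE (card_uniqP _) ?take_uniq ?enum_uniq // size_takel // -cardE //.
pose a i := odflt t0 [pick x in A i].
have aP i : i \in J2 -> [/\ i \in J, [disjoint A i & Z] & A i = [set a i]].
  move=> /(subsetP J21); rewrite inE => /andP[iJ dZ]; split=> //.
  have [_ /set0Pn[x xA] _] := M1 i iJ.
  have : #|A i| <= 1.
    rewrite leqNgt; apply: contra single => lt; apply/exists_inP; exists i => //.
    by rewrite dZ.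
  rewrite /a; case: pickP => [y yA|/(_ x)]; last by rewrite xA.
  by move=> /card_le1_eqP E; apply/setP=> z; rewrite inE; apply/idP/eqP=> [zA|->//]; apply: E.
have a_in i : i \in J2 -> a i \in A i by move=> /aP[_ _ ->]; rewrite inE.
have a_inj : {in J2 &, injective a}.
  move=> i j iJ jJ E; have [iJ' _ _] := aP i iJ; have [jJ' _ _] := aP j jJ.
  by apply: (M2 i j (a i)) => //; [apply: a_in|rewrite E; apply: a_in].
have [F [h [L1 L2]]] : exists F h, linked e V Z (a @: J2) F h.
  apply: menger => //.
  - apply/subsetP=> _ /imsetP[i iJ ->]; have [iJ' _ _] := aP i iJ.
    by have [/subsetP s _ _] := M1 i iJ'; apply: s; apply: a_in.
  - by rewrite card_in_imset.
  move=> X Y sXY ZX ZY; rewrite leqNgt; apply/negP=> lt.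
  have : ~~ (a @: J2 \subset X).
    apply/negP=> sX; have : #|a @: J2| <= #|X :&: Y| by rewrite subset_leq_card // subsetI sX.
    by rewrite card_in_imset // cJ2 leqNgt lt.
  case/subsetPn=> _ /imsetP[i iJ ->] aX; have [iJ' _ E] := aP i iJ.
  have := sep i X Y iJ' sXY ZX; rewrite E disjoints_subset sub1set inE => /(_ aX).
  by rewrite leqNgt lt.
exists (fun l => \bigcup_(s in a @: J2 | c (h s) == l) F s); split=> [l|z zZ|l l' w].
- split; last by apply/bigcupsP=> s /andP[/L1[]].
  apply: (conn_bigcup (h := id)) => // [s /andP[/L1[]]//|s /andP[/L1[]]//|s s'].
  move=> sP sP'; set U := \bigcup_(_ | _) _.
  have inU t : (t \in a @: J2) && (c (h t) == l) -> t \in U.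
    by move=> tP; apply/bigcupP; exists t => //; case/andP: tP => /L1[].
  have := inU _ sP; have := inU _ sP'.
  case/andP: sP => /imsetP[i iJ ->] _; case/andP: sP' => /imsetP[j jJ ->] _ jU iU.
  case: (eqVneq i j) => [->//|ij]; have [iJ' dA EA] := aP i iJ; have [jJ' _ EA'] := aP j jJ.
  have [x [y [xA yA xy]]] := M3 i j iJ' jJ' ij.
  have xZ : x \in Z = false by rewrite (disjointFr dA).
  move: xy; rewrite /add_clique /= xZ orbF; move: xA yA; rewrite EA EA' !inE => /eqP-> /eqP-> xy.
  by apply: connect1; rewrite /induced /= iU jU.
- have onto : h @: (a @: J2) = Z by apply: linked_onto (conj L1 L2) _; rewrite card_in_imset.
  move: zZ; rewrite -onto => /imsetP[s sS ->]; apply/bigcupP; exists s; rewrite ?sS ?eqxx //.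
  by have [] := L1 s sS.
case/bigcupP=> s /andP[sS /eqP<-] w1; case/bigcupP=> s' /andP[sS' /eqP<-] w2.
by rewrite (L2 _ _ _ sS sS' w1 w2).
Qed.

(** * Dense graphs have large clique minors *)

(** Twice the number of edges of the subgraph induced on V. *)
Definition adjacencies (T : finType) (e : rel T) (V : {set T}) : nat :=
  \sum_(x in V) \sum_(y in V) e x y.

Lemma adjacenciesE (T : finType) (e : rel T) (V : {set T}) :
  adjacencies e V = #|[set p : T * T | [&& p.1 \in V, p.2 \in V & e p.1 p.2]]|.
Proof.
rewrite -sum1_card /adjacencies pair_big /= [LHS]big_mkcond [RHS]big_mkcond /=.
by apply: eq_bigr => -[x y] _; rewrite !inE /=; case: (x \in V); case: (y \in V); case: (e x y).
Qed.

Lemma adjacencies_rem (T : finType) (e : rel T) (V : {set T}) v :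
  symmetric e -> irreflexive e -> v \in V ->
  adjacencies e V = adjacencies e (V :\ v) + 2 * \sum_(y in V) e v y.
Proof.
move=> se ie vV; rewrite /adjacencies (bigD1 v) //=.
have -> : \sum_(x in V | x != v) \sum_(y in V) e x y =
   \sum_(x in V :\ v) \sum_(y in V :\ v) e x y + \sum_(x in V :\ v) e v x.
  rewrite -big_split /=; apply: eq_big => [x|x /andP[xV xv]]; first by rewrite !inE andbC.
  rewrite (bigD1 v) //= addnC se; congr (_ + _); apply: eq_bigl => y.
  by rewrite !inE andbC.
have -> : \sum_(y in V) e v y = \sum_(x in V :\ v) e v x.
  rewrite (bigD1 v) //= ie add0n; apply: eq_bigl => y; by rewrite !inE andbC.
lia.
Qed.

(** Contracting uv destroys the edge itself and merges one pair of edges for every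
    common neighbour of u and v. *)
Lemma adjacencies_contract (T : finType) (e : rel T) (V : {set T}) u v :
  symmetric e -> irreflexive e -> u \in V -> v \in V -> e u v ->
  adjacencies e V <=
  adjacencies (contract e u v) (V :\ v) + 2 * (\sum_(y in V) (e u y && e v y)).+1.
Proof.
move=> se ie uV vV uv.
have uNv : u != v by apply: contraTneq uv => ->; rewrite ie.
have uV' : u \in V :\ v by rewrite !inE uNv.
have sc := contract_sym u v se.
have ic : irreflexive (contract e u v) by move=> x; rewrite /contract /= eqxx.
rewrite (adjacencies_rem se ie vV) (adjacencies_rem se ie uV') (adjacencies_rem sc ic uV').
have -> : adjacencies (contract e u v) (V :\ v :\ u) = adjacencies e (V :\ v :\ u).
  apply: eq_bigr => x; rewrite !inE => /andP[xu _]; apply: eq_bigr => y.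
  rewrite !inE => /andP[yu _]; rewrite /contract /= (negPf xu) (negPf yu) /= orbF.
  by case: eqVneq => [->|//]; rewrite ie.
have -> : \sum_(y in V) e v y = 1 + \sum_(y in V :\ v :\ u) e v y.
  rewrite (bigD1 u) //= [e v u]se uv; congr (_ + _).
  rewrite (bigD1 v) ?uNv ?vV 1?eq_sym //= ie add0n; apply: eq_bigl => y.
  by rewrite !inE; case: (y == u); case: (y == v); rewrite ?andbF ?andbT.
have R (f : T -> bool) : f u = false -> \sum_(y in V :\ v) f y = \sum_(y in V :\ v :\ u) f y.
  move=> fu; rewrite (bigD1 u) //= fu add0n; apply: eq_bigl => y.
  by rewrite !inE andbC.
rewrite (R (e u)) ?ie // (R (contract e u v u)) ?ic //.
have S : \sum_(y in V :\ v :\ u) (e u y && e v y) <= \sum_(y in V) (e u y && e v y).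
  rewrite [leqRHS](bigID (fun y => y \in V :\ v :\ u)) /=; apply: leq_trans (leq_addr _ _).
  rewrite big_mkcond [leqRHS]big_mkcond /=; apply: leq_sum => y _.
  by rewrite !inE; case: (y \in V); rewrite ?andbF ?andbT.
have Q : \sum_(y in V :\ v :\ u) e u y + \sum_(y in V :\ v :\ u) e v y <=
   \sum_(y in V :\ v :\ u) contract e u v u y + \sum_(y in V :\ v :\ u) (e u y && e v y).
  rewrite -!big_split /=; apply: leq_sum => y; rewrite !inE => /andP[yu _].
  by rewrite /contract /= eqxx eq_sym yu; case: (e u y); case: (e v y).
lia.
Qed.

Lemma expand_model (T : finType) (I : eqType) (e : rel T) (V : {set T})
    (A : I -> {set T}) (J : {pred I}) (u v : T) :
  symmetric e -> e u v -> u \in V -> v \in V ->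
  clique_model (contract e u v) (V :\ v) A J ->
  clique_model e V (fun i => expand u v (A i)) J.
Proof.
move=> se uv uV vV [M1 M2 M3].
have vA i : i \in J -> v \notin A i.
  by move=> iJ; have [/subsetP s _ _] := M1 i iJ; apply/negP=> /s; rewrite !inE eqxx.
split=> [i iJ|i j x iJ jJ|i j iJ jJ ij].
- have [/subsetP s n c] := M1 i iJ; split.
  + apply/subsetP=> x; rewrite in_expand => /orP[/s|/andP[/eqP->//]].
    by rewrite !inE => /andP[].
  + by case/set0Pn: n => x xA; apply/set0Pn; exists x; rewrite in_expand xA.
  + by apply: conn_expand => //; apply: vA.
- rewrite !in_expand; case: (eqVneq x v) => [->|_] /=; last by rewrite !orbF; apply: M2.
  by rewrite !(negPf (vA _ _)) //=; apply: M2.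
have [x [y [xA yA /andP[_ /or3P[xy|/andP[/eqP Ex vy]|/andP[/eqP Ey xv]]]]]] := M3 i j iJ jJ ij.
- by exists x, y; rewrite !in_expand xA yA.
- by exists v, y; rewrite !in_expand yA eqxx -Ex xA orbT.
- by exists x, v; rewrite !in_expand xA eqxx -Ey yA orbT.
Qed.

(** Mader's argument. An edge with fewer than 2 ^ t common neighbours can be
    contracted without lowering the density below 2 ^ t.+1. If no such edge
    exists, the neighbourhood of a vertex v has density at least 2 ^ t, and {v} is
    a further branch set for a model found there. *)
Lemma dense_clique_model t (T : finType) (e : rel T) (V : {set T}) :
  symmetric e -> irreflexive e -> V != set0 -> 2 ^ t * #|V| <= adjacencies e V ->
  exists A : nat -> {set T}, clique_model e V A [pred i | i < t].
Proof.
elim: t e V => [|t IHt] e V; first by move=> *; exists (fun=> set0); split.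
have [n] := ubnP #|V|; elim: n e V => // n IHn e V /ltnSE leV se ie V0 dense.
pose common u v := \sum_(y in V) (e u y && e v y).
case: (boolP [exists u in V, exists v in V, e u v && (common u v < 2 ^ t)]) => [|rich].
  case/exists_inP=> u uV /exists_inP[v vV /andP[uv few]].
  have cV : #|V| = #|V :\ v|.+1 by rewrite (cardsD1 v) vV.
  have [|||||A MA] := IHn (contract e u v) (V :\ v).
  - by rewrite -cV.
  - exact: contract_sym.
  - by move=> x; rewrite /contract /= eqxx.
  - by apply/set0Pn; exists u; rewrite !inE uV andbT; apply: contraTneq uv => ->; rewrite ie.
  - have := adjacencies_contract se ie uV vV uv; move: dense few.
    rewrite cV -/(common u v) expnS; nia.
  by exists (fun i => expand u v (A i)); apply: expand_model.
have {}rich u v : u \in V -> v \in V -> e u v -> 2 ^ t <= common u v.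
  move=> uV vV uv; rewrite leqNgt; apply: contra rich => few.
  by apply/exists_inP; exists u => //; apply/exists_inP; exists v; rewrite ?uv.
have [v vV [w wV vw]] : exists2 v, v \in V & exists2 w, w \in V & e v w.
  case: (boolP [exists v in V, exists w in V, e v w]) => [|no].
    by case/exists_inP=> v vV /exists_inP[w wV vw]; exists v => //; exists w.
  move: dense; rewrite /adjacencies big1 => [|v vV].
    by rewrite leqn0 muln_eq0 expn_eq0 /= cards_eq0 (negPf V0).
  rewrite big1 // => w wV; apply/eqP; rewrite eqb0; apply: contra no => vw.
  by apply/exists_inP; exists v => //; apply/exists_inP; exists w.
pose N := [set y in V | e v y].
have NV : N \subset V by apply/subsetP=> y; rewrite inE => /andP[].
have [||||A [M1 M2 M3]] := IHt e N => //.
- by apply/set0Pn; exists w; rewrite inE wV.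
- rewrite mulnC -sum_nat_const /adjacencies; apply: leq_sum => x; rewrite inE => /andP[xV vx].
  apply: leq_trans (rich v x vV xV vx) _; rewrite /common big_mkcond [leqRHS]big_mkcond.
  apply: leq_sum => y _; rewrite inE; case: (y \in V); case: (e v y) => //=.
have vN : v \notin N by rewrite inE ie andbF.
have lt i : (i < t.+1) -> i != t -> i < t by rewrite ltnS ltn_neqAle => -> ->.
have vA i : i < t -> v \notin A i.
  by move=> it; have [/subsetP s _ _] := M1 i it; apply: contra vN => /s.
exists (fun i => if i == t then [set v] else A i).
split=> [i|i j x|i j]; rewrite !inE.
- move=> it; case: eqVneq => [_|/(lt _ it) it'].
    by split; [rewrite sub1set | apply/set0Pn; exists v; rewrite inE | apply: conn1].
  by have [s n' c] := M1 i it'; split=> //; apply: subset_trans s NV.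
- move=> it jt; case: eqVneq => [->|/(lt _ it) it']; case: eqVneq => [->|/(lt _ jt) jt'] //.
  + by rewrite inE => /eqP->; rewrite (negPf (vA _ jt')).
  + by move=> xA; rewrite inE => /eqP E; move: xA; rewrite E (negPf (vA _ it')).
  + exact: M2.
move=> it jt ij; case: (eqVneq i t) ij => [->|/(lt _ it) it'] ij;
  case: (eqVneq j t) ij => [_|/(lt _ jt) jt'] ij.
- by [].
- have [/subsetP s /set0Pn[y yA] _] := M1 j jt'; exists v, y; rewrite !inE yA; split=> //.
  by move: (s y yA); rewrite inE => /andP[].
- have [/subsetP s /set0Pn[y yA] _] := M1 i it'; exists y, v; rewrite !inE yA; split=> //.
  by move: (s y yA); rewrite inE se => /andP[].
- exact: M3.
Qed.

(** * Short paths in graphs of large girth *)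

Definition girth_geq (T : finType) (e : rel T) (k : nat) : Prop :=
  forall c : seq T, graph_cycle e c -> k <= size c.

(** The only way in which girth is used. Two different paths from x are stripped of
    their common beginning; the first vertex where they meet again closes a cycle
    no longer than both paths together. *)
Lemma short_paths_eq (T : finType) (e : rel T) (k : nat) (x : T) (p p' : seq T) :
  symmetric e -> girth_geq e k ->
  path e x p -> uniq (x :: p) -> path e x p' -> uniq (x :: p') ->
  last x p = last x p' -> size p + size p' < k -> p = p'.
Proof.
move=> se girth; elim: p x p' => [|y p IH] x [|y' p'] //=.
- by move=> _ _ _ /andP[/negP xp' _] E; case: xp'; rewrite E mem_last.
- by move=> _ /andP[/negP xp _] _ _ E; case: xp; rewrite -E mem_last.
case: (eqVneq y y') => [<-|ne] /andP[xy yp] /andP[xnp up] /andP[xy' yp'] /andP[xnp' up'] El lt.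
  by rewrite (IH y p') //; move: lt; clear; lia.
pose q := y :: p; pose q' := y' :: p'.
have hasq : has (mem q') q.
  by apply/hasP; exists (last y p); [exact: mem_last|rewrite El; exact: mem_last].
have pq : path e x q by rewrite /= xy.
have pq' : path e x q' by rewrite /= xy'.
have uq : uniq (x :: q) by rewrite cons_uniq xnp.
have uq' : uniq (x :: q') by rewrite cons_uniq xnp'.
have hd : ohead q != ohead q' by rewrite /=; apply: contra ne => /eqP[->].
have {}lt : size q + size q' < k by [].
exfalso; clearbody q q'; move: hd lt pq uq.
case/split_find: hasq => w q1 q2 wq' q1q'; move: wq' q1q' pq' uq' => /=.
case/splitPr => r1 r2 no pq' uq' hd lt pq uq.
move: pq' uq'; rewrite cat_path /= => /and3P[pr1 wr1 _].
rewrite mem_cat inE !negb_or cat_uniq /= => /andP[/and3P[xr1 xw _]].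
rewrite !negb_or => /and4P[ur1 /andP[wNr1 _] _ _].
move: pq uq; rewrite cat_path => /andP[pq1 _].
rewrite mem_cat mem_rcons inE !negb_or cat_uniq rcons_uniq.
move=> /andP[/andP[/andP[_ xq1] _] /andP[/andP[wNq1 uq1] _]].
pose c := x :: q1 ++ w :: rev r1.
have : graph_cycle e c.
  split.
    rewrite /c /= size_cat /= size_rev; case: q1 r1 hd {c pr1 wr1 xr1 ur1 wNr1 lt pq1 xq1 wNq1 uq1 no} => [|? ?] [|? ?] //=.
    - by rewrite eqxx.
    - by rewrite addn1.
    - by rewrite !addnS.
  rewrite /ucycle; apply/andP; split; last first.
    rewrite /c /= mem_cat inE mem_rev !negb_or xq1 xw xr1 /= cat_uniq uq1 /= rev_uniq ur1 mem_rev wNr1.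
    rewrite negb_or wNq1 !andbT /=; apply/hasPn => z; rewrite mem_rev => zr1.
    by apply/negP=> zq; move/hasPn: no => /(_ z zq); rewrite /= mem_cat zr1.
  rewrite /c /= rcons_cat /= -cat_rcons cat_path pq1 last_rcons /=.
  have := rev_path e x (rcons r1 w); rewrite last_rcons belast_rcons rev_cons => ->.
  by rewrite rcons_path; under eq_path do rewrite se; rewrite se wr1 pr1.
move/girth; rewrite /c /= !size_cat /= size_rev; move: lt; clear; rewrite !size_cat size_rcons /=; lia.
Qed.

(** * Balls and breadth-first forests *)

Definition ball (T : finType) (e : rel T) (X : {set T}) (n : nat) : {set T} :=
  iter n (fun B => B :|: [set y | [exists x in B, e x y]]) X.

Lemma ballSP (T : finType) (e : rel T) (X : {set T}) n y :
  reflect (y \in ball e X n \/ exists2 x, x \in ball e X n & e x y) (y \in ball e X n.+1).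
Proof.
rewrite /= !inE; apply: (iffP orP) => -[->|]; try by left.
  by case/exists_inP=> x xB xy; right; exists x.
by case=> x xB xy; right; apply/exists_inP; exists x.
Qed.

Lemma subset_ball (T : finType) (e : rel T) (X : {set T}) m n :
  m <= n -> ball e X m \subset ball e X n.
Proof.
move=> /subnK<-; elim: (n - m) => // i IH; apply: subset_trans IH _; exact: subsetUl.
Qed.

Lemma path_ball (T : finType) (e : rel T) (x : T) p n :
  symmetric e -> path e x p -> size p <= n -> x \in ball e [set last x p] n.
Proof.
move=> se pp sp; apply: (subsetP (subset_ball _ _ sp)).
elim: p x pp {sp} => [|y p IH] x /=; first by rewrite inE.
move=> /andP[xy pp]; apply/ballSP; right; exists y; last by rewrite se.
exact: IH.
Qed.

Lemma ball_path (T : finType) (e : rel T) (x y : T) n :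
  y \in ball e [set x] n -> exists p, [/\ path e x p, last x p = y & size p <= n].
Proof.
elim: n y => [|n IH] y; first by rewrite inE => /eqP->; exists [::].
case/ballSP=> [/IH[p [p1 p2 p3]]|[z /IH[p [p1 p2 p3]] zy]].
  by exists p; split=> //; apply: leqW.
exists (rcons p y).
by rewrite rcons_path p1 p2 zy last_rcons size_rcons.
Qed.

(** A breadth-first forest of depth N grown from X: d is the distance to X, root v
    the element of X below which v hangs, and par v the next vertex on the way
    there. *)
Definition bfs_forest (T : finType) (e : rel T) (X : {set T}) (N : nat)
    (d : T -> nat) (par root : T -> T) : Prop :=
  forall v, v \in ball e X N ->
  [/\ forall n, n <= N -> (v \in ball e X n) = (d v <= n),
      root v \in X, v \in X -> root v = v &
      v \notin X ->
      [/\ e v (par v), d (par v) < d v, par v \in ball e X N & root (par v) = root v]].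

Lemma bfs_forest_exists (T : finType) (e : rel T) (X : {set T}) N :
  symmetric e -> exists d par root, bfs_forest e X N d par root.
Proof.
move=> se.
pose d v := find (fun n => v \in ball e X n) (iota 0 N.+1).
have dP v n : v \in ball e X N -> n <= N -> (v \in ball e X n) = (d v <= n).
  move=> vN nN.
  have hasN : has (fun n => v \in ball e X n) (iota 0 N.+1).
    by apply/hasP; exists N; rewrite // mem_iota /= add0n.
  have dlt : d v < N.+1 by rewrite -[N.+1](size_iota 0) -has_find.
  apply/idP/idP => [vn|dn].
    rewrite leqNgt; apply/negP => /(before_find 0).
    by rewrite nth_iota ?vn.
  apply: (subsetP (subset_ball _ _ dn)).
  by have := nth_find 0 hasN; rewrite nth_iota.
pose par v := if v \in X then v else odflt v [pick w | e v w && (d w < d v) & w \in ball e X N].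
have parP v : v \in ball e X N -> v \notin X ->
    [/\ e v (par v), d (par v) < d v & par v \in ball e X N].
  move=> vN vX; rewrite /par (negPf vX).
  suff [w [vw dw wN]] : exists w, [/\ e v w, d w < d v & w \in ball e X N].
    case: pickP => [z /andP[/andP[-> ->] ->] //|/(_ w)]; by rewrite /= vw dw wN.
  have dN : d v <= N by rewrite -dP.
  case Ed: (d v) dN => [|m] mN; first by have := dP v 0 vN isT; rewrite Ed /= (negPf vX).
  have : v \in ball e X m.+1 by rewrite dP ?Ed.
  case/ballSP=> [|[w wm wv]]; first by rewrite dP ?Ed ?ltnn // ltnW.
  have wN : w \in ball e X N by apply: (subsetP (subset_ball _ _ (ltnW mN))).
  by exists w; rewrite se wv wN ltnS -dP // ltnW.
have parX v : v \in X -> par v = v by rewrite /par => ->.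
pose root v := iter N par v.
have iterX n v : v \in X -> iter n par v = v.
  by move=> vX; elim: n => //= n ->; apply: parX.
have toX n v : v \in ball e X N -> d v <= n -> iter n par v \in X.
  elim: n v => [|n IH] v vN; first by rewrite /= -(dP v 0).
  rewrite iterSr => dn; case vX: (v \in X).
    by rewrite parX // iterX.
  have [_ lt pN] := parP v vN (negbT vX); apply: IH => //.
  by rewrite -ltnS; apply: leq_trans lt dn.
exists d, par, root => v vN; split=> [n nN|||vX].
- exact: dP.
- by apply: toX; rewrite -?dP.
- exact: iterX.
have [vp lt pN] := parP v vN vX; split=> //.
have rX : root v \in X by apply: toX; rewrite -?dP.
rewrite {1}/root -iterSr iterS -/(root v); exact: parX.
Qed.

Lemma descent (T : finType) (e : rel T) (X : {set T}) N d par root v :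
  bfs_forest e X N d par root -> v \in ball e X N ->
  exists p, [/\ path e v p && uniq (v :: p), last v p = root v, size p <= d v,
    forall w, w \in p -> [/\ d w < d v, w \in ball e X N & root w = root v] &
    p = [::] \/ ohead p = Some (par v)].
Proof.
move=> F; have [n] := ubnP (d v); elim: n v => // n IH v /ltnSE dv vN.
have [_ rX rv step] := F v vN.
case vX: (v \in X); first by exists [::]; rewrite rv //; split=> //; left.
have [vp lt pN rp] := step (negbT vX).
have [p [/andP[pp up] lp sp Hp hp]] := IH (par v) (leq_trans lt dv) pN.
have Hq w : w \in par v :: p -> [/\ d w < d v, w \in ball e X N & root w = root v].
  rewrite inE => /orP[/eqP->//|/Hp[dw wN rw]]; split=> //; last by rewrite rw.
  exact: ltn_trans dw lt.
have vNp : v \notin par v :: p by apply/negP=> /Hq[]; rewrite ltnn.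
exists (par v :: p); split=> //=; last by right.
- by move: up => /= ->; rewrite vp pp vNp.
- by rewrite lp.
- exact: leq_ltn_trans sp lt.
Qed.

(** Each tree of the forest is an induced subgraph: were vw an edge outside the
    tree, then v would reach its root along the tree and also through w. *)
Lemma bfs_forest_edge (T : finType) (e : rel T) (X : {set T}) N k d par root v w :
  symmetric e -> girth_geq e k -> 2 * N + 1 < k ->
  bfs_forest e X N d par root -> v \in ball e X N -> w \in ball e X N ->
  v != w -> e v w -> root v = root w -> w = par v \/ v = par w.
Proof.
move=> se girth Nk F; wlog dwv : v w / d w <= d v => [W|] vN wN vw evw rvw.
  case/orP: (leq_total (d w) (d v)) => [dwv|dvw]; first exact: W.
  by have [] := W w v dvw wN vN; rewrite 1?eq_sym 1?se // ; [right|left].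
have [p [/andP[pp up] lp sp _ hp]] := descent F vN.
have [q [/andP[qp uq] lq sq Hq _]] := descent F wN.
have [dv _ _ _] := F v vN; have [dw _ _ _] := F w wN.
have dvN : d v <= N by rewrite -dv.
have dwN : d w <= N by rewrite -dw.
have E : p = w :: q.
  apply: (short_paths_eq se girth pp up); rewrite /= ?evw ?lp ?lq //.
    rewrite inE negb_or vw /= -/(uniq (w :: q)) uq andbT; apply/negP=> /Hq[lt _ _].
    by rewrite ltnNge dwv in lt.
  by move: sp sq dvN dwN Nk; clear; lia.
by left; case: hp; rewrite E // => -[->].
Qed.

(** By the previous lemma every edge within a tree is charged to its lower end. *)
Lemma bfs_forest_sparse (T : finType) (e : rel T) (X U : {set T}) N k d par root :
  symmetric e -> irreflexive e -> girth_geq e k -> 2 * N + 1 < k ->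
  bfs_forest e X N d par root -> U \subset ball e X N ->
  \sum_(v in U) \sum_(w in U) (e v w && (root v == root w)) <= 2 * #|U|.
Proof.
move=> se ie girth Nk F /subsetP UN.
have one (f : T -> T) : \sum_(v in U) \sum_(w in U) (w == f v) <= #|U|.
  rewrite -sum1_card; apply: leq_sum => v _; rewrite -big_mkcondr /=.
  case fU: (f v \in U); last first.
    by rewrite big1 // => w /andP[wU]; case: eqP wU => // ->; rewrite fU.
  rewrite (bigD1 (f v)) ?fU ?eqxx //= big1 // => w /andP[/andP[_ /eqP->]].
  by rewrite eqxx.
apply: leq_trans (_ : \sum_(v in U) \sum_(w in U) ((w == par v) + (v == par w)) <= _).
  apply: leq_sum => v vU; apply: leq_sum => w wU.
  case vw: (e v w) => //=; case: eqP => //= rvw.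
  have ne : v != w by apply: contraTneq vw => ->; rewrite ie.
  by case: (bfs_forest_edge se girth Nk F (UN _ vU) (UN _ wU) ne vw rvw) => ->; rewrite eqxx ?addn1.
under eq_bigr do rewrite big_split /=.
rewrite big_split /= mul2n -addnn; apply: leq_add; first exact: one.
rewrite exchange_big /=; exact: one.
Qed.

(** Moore's bound. The ball of radius r + 1 spans a tree, hence at most as many
    edges as it has vertices, yet it contains all the edges at the ball of
    radius r. *)
Lemma ball_growth (T : finType) (e : rel T) (x : T) h r k :
  symmetric e -> irreflexive e -> girth_geq e k -> 2 * r + 1 < k ->
  (forall v, v \in ball e [set x] r -> 2 * h <= \sum_w e v w) ->
  h ^ r <= #|ball e [set x] r|.
Proof.
move=> se ie girth; elim: r => [|r IH] rk deg; first by rewrite cards1.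
have sub := subset_ball e [set x] (leqnSn r).
rewrite expnS; apply: leq_trans (leq_mul (leqnn h) (IH _ _)) _.
- by move: rk; clear; lia.
- by move=> v /(subsetP sub); apply: deg.
have [d [par [root F]]] := bfs_forest_exists [set x] r.+1 se.
have := bfs_forest_sparse se ie girth rk F (subxx _).
set U := ball _ _ r.+1 => S.
rewrite -(leq_pmul2l (isT : 0 < 2)); apply: leq_trans S.
rewrite mulnA mulnC -sum_nat_const.
apply: leq_trans (_ : \sum_(v in ball e [set x] r) \sum_(w in U) (e v w && (root v == root w)) <= _).
  apply: leq_sum => v vB; have vU := subsetP sub v vB.
  apply: leq_trans (deg v vU) _; rewrite [leqRHS]big_mkcond; apply: leq_sum => w _.
  case vw: (e v w) => //=.
  have wU : w \in U by apply/ballSP; right; exists v.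
  have [_ + _ _] := F v vU; have [_ + _ _] := F w wU; rewrite !in_set1 wU.
  by move=> /eqP-> /eqP->; rewrite eqxx.
rewrite [leqRHS](bigID (fun v => v \in ball e [set x] r)) /=; apply: leq_trans (leq_addr _ _).
rewrite big_mkcond [leqRHS]big_mkcond /=; apply: leq_sum => v _.
by case vB: (v \in ball _ _ r); rewrite ?andbF // (subsetP sub _ vB).
Qed.

(** * Clique minors from large girth *)

Lemma path_induced (T : finType) (e : rel T) (L : {set T}) x p :
  path e x p -> {subset x :: p <= L} -> path (induced e L) x p.
Proof.
elim: p x => //= y p IH x /andP[xy pp] sub; rewrite /induced /= !sub ?inE ?eqxx ?orbT // xy /=.
by apply: IH => // z zp; apply: sub; rewrite inE zp orbT.
Qed.

Lemma rev_walk (T : finType) (e : rel T) x p :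
  symmetric e -> path e x p ->
  exists q, [/\ path e (last x p) q, last (last x p) q = x, size q = size p & {subset q <= x :: p}].
Proof.
move=> se pp; exists (rev (belast x p)); split.
- by rewrite rev_path; under eq_path do rewrite se.
- by case: p {pp} => //= y p; rewrite rev_cons last_rcons.
- by rewrite size_rev size_belast.
- by move=> z; rewrite mem_rev; apply: mem_belast.
Qed.

Lemma walk_shorten (T : finType) (e : rel T) x p :
  path e x p -> exists q, [/\ path e x q, uniq (x :: q), last x q = last x p,
    size q <= size p & {subset q <= p}].
Proof.
case/shortenP=> q qp uq sub; exists q; split=> //.
by apply: uniq_leq_size sub; case/andP: uq.
Qed.

Lemma ball_walk (T : finType) (e : rel T) (X : {set T}) n x p :
  x \in ball e X n -> path e x p -> last x p \in ball e X (n + size p).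
Proof.
elim: p x n => [|y p IH] x n xn /=; first by rewrite addn0.
by case/andP=> xy pp; rewrite addnS -addSn; apply: IH => //; apply/ballSP; right; exists x.
Qed.

Lemma subset_ballr (T : finType) (e : rel T) (X Y : {set T}) n :
  X \subset Y -> ball e X n \subset ball e Y n.
Proof.
move=> XY; elim: n => // n /subsetP IH; apply/subsetP=> y /ballSP[/IH|[x /IH xn xy]] .
  by move=> yn; apply/ballSP; left.
by apply/ballSP; right; exists x.
Qed.

Lemma ball_support (T : finType) (e : rel T) (X U : {set T}) n :
  (forall x y, e x y -> y \in U) -> X \subset U -> ball e X n \subset U.
Proof.
move=> eU XU; elim: n => // n /subsetP IH; apply/subsetP=> y /ballSP[/IH//|[x _]]; exact: eU.
Qed.

(** If v were farther than 2 * r from the maximal packing X, its ball of radius r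
    would be disjoint from the other balls, and v could be added to X. *)
Lemma maximal_packing (T : finType) (e : rel T) (U : {set T}) r :
  symmetric e -> exists X : {set T}, [/\ X \subset U,
    forall x y v, x \in X -> y \in X -> v \in ball e [set x] r -> v \in ball e [set y] r -> x = y &
    U \subset ball e X (2 * r)].
Proof.
move=> se.
pose P (X : {set T}) := (X \subset U) && [forall x in X, forall y in X, (x != y) ==>
  [disjoint ball e [set x] r & ball e [set y] r]].
have P0 : P set0 by rewrite /P sub0set; apply/forall_inP=> x; rewrite inE.
have [X /maxsetP[/andP[XU /forall_inP dX] maxX] _] := maxset_exists P0.
have dXP x y v : x \in X -> y \in X -> v \in ball e [set x] r -> v \in ball e [set y] r -> x = y.
  move=> xX yX vx vy; apply/eqP; apply: contraT => xy.
  move/forall_inP: (dX x xX) => /(_ y yX) /implyP/(_ xy) d.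
  by rewrite (disjointFr d vx) in vy.
exists X; split=> //; apply/subsetP=> v vU.
case vX: (v \in X); first exact: (subsetP (subset_ball e X (leq0n _))).
case: (boolP [exists x in X, ~~ [disjoint ball e [set v] r & ball e [set x] r]]) => [|none].
  case/exists_inP=> x xX /pred0Pn[w /andP[wv wx]].
  have [p [pp lp sp]] := ball_path wv; have [q [qp lq sq _]] := rev_walk se pp.
  have /subsetP/(_ w wx) wX : ball e [set x] r \subset ball e X r.
    by apply: subset_ballr; rewrite sub1set.
  rewrite lp in qp lq; have := ball_walk wX qp; rewrite lq.
  have rs : r + size q <= 2 * r by rewrite sq mul2n -addnn leq_add2l.
  exact: (subsetP (subset_ball e X rs)).
have : v |: X = X; last by move=> XE; rewrite -XE setU11 in vX.
apply: maxX (subsetUr _ _); rewrite /P subUset sub1set vU XU /=.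
have dv x : x \in X -> [disjoint ball e [set v] r & ball e [set x] r].
  by move=> xX; apply: contraR none => nd; apply/exists_inP; exists x.
apply/forall_inP=> x; rewrite !inE => /orP[/eqP->|xX]; apply/forall_inP=> y; rewrite !inE => /orP[/eqP->|yX].
- by rewrite eqxx.
- by apply/implyP=> _; apply: dv.
- by apply/implyP=> _; rewrite disjoint_sym; apply: dv.
- by move/forall_inP: (dX x xX) => /(_ y yX).
Qed.

(** Large girth and large minimum degree force a clique minor of order linear in
    the girth, with large branch sets. The vertices are partitioned into the
    trees of a breadth-first forest of depth 2 * r whose roots form a maximal
    packing of balls of radius r, so each block contains such a ball. Blocks
    absorb few edges and two blocks are joined by at most one edge, so
    contracting the blocks multiplies the density by their size, which is
    exponential in r. *)
Lemma girth_clique_model (T : finType) (e : rel T) (U : {set T}) h r k t :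
  symmetric e -> irreflexive e -> girth_geq e k -> 8 * r + 2 < k ->
  (forall x y, e x y -> y \in U) -> U != set0 -> (forall v, v \in U -> 2 * h <= \sum_w e v w) ->
  2 ^ t <= (2 * h - 2) * h ^ r ->
  exists A : nat -> {set T}, clique_model e U A [pred i | i < t] /\
    forall i, i < t -> h ^ r <= #|A i|.
Proof.
move=> se ie girth rk eU U0 deg large.
have rk1 : 2 * r + 1 < k by move: rk; clear; lia.
have rk2 : 2 * (2 * r) + 1 < k by move: rk; clear; lia.
have [X [XU sepX coverX]] := maximal_packing U r se.
have BU : ball e X (2 * r) \subset U by apply: ball_support.
have [d [par [root F]]] := bfs_forest_exists X (2 * r) se.
have rootX v : v \in U -> root v \in X by move=> /(subsetP coverX)/F[].
have rootU v : v \in U -> root v \in U by move=> /rootX; apply: (subsetP XU).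
have root_id x : x \in X -> root x = x.
  by move=> xX; have [_ _ -> //] := F x (subsetP coverX _ (subsetP XU _ xX)).
pose block x := [set v in U | root v == x].
have in_block v : v \in U -> v \in block (root v) by move=> vU; rewrite inE vU eqxx.
have descU v : v \in U -> exists p, [/\ path e v p, last v p = root v, size p <= d v,
    d v <= 2 * r & {subset v :: p <= block (root v)}].
  move=> vU; have vN := subsetP coverX v vU.
  have [p [/andP[pp _] lp sp Hp _]] := descent F vN; exists p; split=> //.
    by have [<-] := F v vN.
  move=> w; rewrite inE => /orP[/eqP->|/Hp[_ wN rw]]; first exact: in_block.
  by rewrite inE (subsetP BU) // rw eqxx.
have walk v v' : v \in U -> v' \in U -> root v = root v' ->
    exists p, [/\ path e v p, uniq (v :: p), last v p = v', size p <= 4 * r & {subset p <= block (root v)}].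
  move=> vU vU' rr; have [p [pp lp sp dp bp]] := descU v vU.
  have [q0 [qp0 lq0 sq0 dq0 bq0]] := descU v' vU'.
  have [q [qp lq sq sub]] := rev_walk se qp0.
  rewrite lq0 -rr in qp lq.
  have : path e v (p ++ q) by rewrite cat_path pp lp.
  case/walk_shorten=> p' [pp' up' lp' sp' sub']; exists p'; split=> //.
  - by rewrite lp' last_cat lp lq.
  - apply: leq_trans sp' _; rewrite size_cat sq.
    apply: leq_trans (leq_add (leq_trans sp dp) (leq_trans sq0 dq0)) _; clear; lia.
  - move=> w /sub'; rewrite mem_cat => /orP[wp|/sub/bq0]; last by rewrite rr.
    by apply: bp; rewrite inE wp orbT.
have block_conn x : conn e (block x).
  move=> v v'; rewrite inE => /andP[vU /eqP<-]; rewrite inE => /andP[vU' /eqP rr].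
  have [p [pp _ <- _ bp]] := walk v v' vU vU' (esym rr).
  apply/connectP; exists p => //; apply: path_induced => // w.
  by rewrite inE => /orP[/eqP->|/bp//]; apply: in_block.
have block_size x : x \in X -> h ^ r <= #|block x|.
  move=> xX.
  have sB : ball e [set x] r \subset ball e X r by apply: subset_ballr; rewrite sub1set.
  have rr : r <= 2 * r by rewrite mul2n -addnn leq_addr.
  have sU : ball e [set x] r \subset U.
    by apply: ball_support => //; rewrite sub1set (subsetP XU).
  apply: leq_trans (ball_growth se ie girth rk1 _) _.
    by move=> v /(subsetP sU); apply: deg.
  apply: subset_leq_card; apply/subsetP=> v vB; have vU := subsetP sU v vB.
  have [Dv _ _ _] := F v (subsetP coverX v vU).
  have dv : d v <= r by rewrite -Dv // (subsetP sB).
  have [p [pp lp sp _ _]] := descU v vU.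
  rewrite inE vU /=; apply/eqP; apply: (sepX _ _ v) => //; first exact: rootX.
  by rewrite -lp; apply: path_ball => //; apply: leq_trans sp dv.
pose cross : {set T * T} := [set p | [&& p.1 \in U, p.2 \in U & e p.1 p.2 && (root p.1 != root p.2)]].
(* Two edges between the same two blocks would close a cycle shorter than k. *)
have cross_inj : {in cross &, injective (fun p => (root p.1, root p.2))}.
  move=> [v w] [v' w']; rewrite !inE /= => /and4P[vU wU vw rvw] /and4P[vU' wU' vw' rvw'] [rv rw].
  have [p [pp up lp sp bp]] := walk v v' vU vU' rv.
  have [q [qp uq lq sq bq]] := walk w' w wU' wU (esym rw).
  have far z : z \in w' :: q -> z \in block (root w).
    by rewrite inE => /orP[/eqP->|/bq]; rewrite rw //; apply: in_block.
  have E : [:: w] = p ++ w' :: q.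
    apply: (short_paths_eq se girth (x := v)).
    - by rewrite /= vw.
    - by rewrite /= inE andbT; apply: contraTneq vw => ->; rewrite ie.
    - by rewrite cat_path pp lp /= vw'.
    - rewrite -cat_cons cat_uniq up uq andbT; apply/hasPn=> z /far.
      rewrite inE => /andP[zU /eqP rz]; apply/negP; rewrite /= inE => /orP[/eqP E|/bp].
        by rewrite -rz E eqxx in rvw.
      by rewrite inE rz eq_sym (negPf rvw) andbF.
    - by rewrite last_cat /= lq.
    - by rewrite /= size_cat /=; move: sp sq rk; clear; lia.
  by case: p E lp {pp up sp bp} => [|a [|b p]] //= [->] _ ->.
pose eM : rel T := [rel x y | (x != y) && [exists v, exists w, [&& e v w, root v == x & root w == y]]].
have eV v w : e v w -> v \in U /\ w \in U by move=> vw; split; [apply: (eU w); rewrite se|apply: eU vw].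
have [A MA] : exists A : nat -> {set T}, clique_model eM X A [pred i | i < t].
  apply: dense_clique_model.
  - move=> x y; rewrite /eM /= eq_sym; congr (_ && _); apply/existsP/existsP=> -[v /existsP[w /and3P[vw rv rw]]];
    by exists w; apply/existsP; exists v; rewrite se vw rv rw.
  - by move=> x; rewrite /eM /= eqxx.
  - by case/set0Pn: U0 => v vU; apply/set0Pn; exists (root v); apply: rootX.
  rewrite adjacenciesE.
  have cU : h ^ r * #|X| <= #|U|.
    have -> : #|U| = \sum_(x in X) #|block x|.
      rewrite -sum1_card (partition_big root (mem X)) //=; apply: eq_bigr => x _.
      by rewrite -sum1_card; apply: eq_bigl => v; rewrite inE.
    by rewrite mulnC -sum_nat_const; apply: leq_sum => x; apply: block_size.
  have cC : (2 * h - 2) * #|U| <= #|cross|.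
    have -> : #|cross| = \sum_(v in U) \sum_(w in U) (e v w && (root v != root w)).
      rewrite -sum1_card pair_big /= [LHS]big_mkcond [RHS]big_mkcond /=.
      apply: eq_bigr => -[v w] _; rewrite inE /=.
      by case: (v \in U); case: (w \in U); case: (e v w && _).
    have S := bfs_forest_sparse se ie girth rk2 F coverX.
    rewrite mulnBl leq_subLR; apply: leq_trans _ (leq_add S (leqnn _)).
    rewrite mulnC -sum_nat_const -big_split /=; apply: leq_sum => v vU.
    apply: leq_trans (deg v vU) _; rewrite -big_split /= [leqRHS]big_mkcond; apply: leq_sum => w _.
    case vw: (e v w) => //; have [_ ->] := eV v w vw; by case: (_ == _).
  apply: leq_trans (leq_mul large (leqnn _)) _; rewrite -mulnA.
  apply: leq_trans (leq_mul (leqnn _) cU) _; apply: leq_trans cC _.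
  rewrite -(card_in_imset cross_inj); apply: subset_leq_card; apply/subsetP=> _ /imsetP[[v w] + ->].
  rewrite !inE /= => /and4P[vU wU vw rvw]; rewrite !rootX // /eM /= rvw /=.
  by apply/existsP; exists v; apply/existsP; exists w; rewrite vw !eqxx.
have [M1 M2 M3] := MA.
have self x : x \in X -> x \in block x.
  by move=> xX; rewrite inE (subsetP XU) // root_id ?eqxx.
exists (fun i => \bigcup_(x in A i) block x); split; last first.
  move=> i it; have [/subsetP s /set0Pn[x xA] _] := M1 i it.
  apply: leq_trans (block_size x (s x xA)) _; apply: subset_leq_card.
  exact: (bigcup_sup x).
split=> [i it|i j v it jt|i j it jt ij].
- have [/subsetP s /set0Pn[x xA] c] := M1 i it; split.
  + by apply/bigcupsP=> y _; apply/subsetP=> v; rewrite inE => /andP[].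
  + by apply/set0Pn; exists x; apply/bigcupP; exists x => //; apply: self; apply: s.
  apply: (conn_bigcup (h := id)) => // [y yA|y z yA zA]; first by apply: self; apply: s.
  apply: (@connect_homo _ _ (induced eM (A i)) _ id); last exact: c.
  move=> a b /and3P[aA bA /andP[_ /existsP[v /existsP[w /and3P[vw /eqP rv /eqP rw]]]]].
  have [vU wU] := eV v w vw; set W := \bigcup_(_ in _) _.
  have sub a' : a' \in A i -> block a' \subset W by move=> a'A; apply: bigcup_sup.
  have va : v \in block a by rewrite -rv; apply: in_block.
  have wb : w \in block b by rewrite -rw; apply: in_block.
  apply: (connect_trans (y := v)); first by apply: connect_induced_sub (sub a aA) _; apply: block_conn => //; apply: self; apply: s.
  apply: (connect_trans (y := w)); last by apply: connect_induced_sub (sub b bA) _; apply: block_conn => //; apply: self; apply: s.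
  by apply: connect1; rewrite /induced /= vw (subsetP (sub a aA)) // (subsetP (sub b bA)).
- case/bigcupP=> x xA /setIdP[_ /eqP rx] /bigcupP[y yA /setIdP[_ /eqP ry]].
  by apply: M2 xA _ => //; rewrite -rx ry.
have [x [y [xA yA /andP[_ /existsP[v /existsP[w /and3P[vw /eqP rv /eqP rw]]]]]]] := M3 i j it jt ij.
have [vU wU] := eV v w vw.
exists v, w; split=> //; apply/bigcupP; [exists x|exists y] => //; rewrite -?rv -?rw; exact: in_block.
Qed.

(** * An extremal subgraph that expands *)

Lemma trunc_log2_leS a n : 0 < a -> n <= 2 * a -> trunc_log 2 n <= (trunc_log 2 a).+1.
Proof. by move=> a0 na; rewrite -trunc_logMp //; apply: leq_trunc_log. Qed.

Lemma adjacencies_le_square (T : finType) (e : rel T) (U : {set T}) :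
  adjacencies e U <= #|U| * #|U|.
Proof.
rewrite /adjacencies -sum_nat_const; apply: leq_sum => x _.
by rewrite -sum1_card; apply: leq_sum => y _; apply: leq_b1.
Qed.

Lemma adjacencies_separation (T : finType) (e : rel T) (U A B : {set T}) :
  symmetric e -> separation e U A B ->
  adjacencies e U <= adjacencies e A + adjacencies e B.
Proof.
move=> se /separationP[UE sAB]; rewrite !adjacenciesE.
apply: leq_trans (leq_card_setU _ _); apply: subset_leq_card.
apply/subsetP=> -[x y]; rewrite !inE /= -UE !inE.
case xy: (e x y); rewrite ?andbF // !andbT.
case xA: (x \in A); case yA: (y \in A); case xB: (x \in B); case yB: (y \in B) => //= _.
- by have := sAB x y; rewrite xA xB yB yA xy => /(_ isT isT isT isT).
- by have := sAB y x; rewrite yA yB xB xA se xy => /(_ isT isT isT isT).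
Qed.

(** The set U is minimal with #|U| >= q and
    4 q #|U| <= adjacencies U + 2 q (q + log #|U|). Dropping a vertex of degree at
    most q would preserve the inequality. If both sides A and B of a separation
    violate it, then adding the two violations makes the defects on the right,
    q + log #|A| and q + log #|B|, compete with the single defect q + log #|U|,
    and the difference must be paid by the order of the separation. The logarithm
    is concave enough for this and makes the order grow with the smaller side;
    the constant q takes care of small sides. *)
Lemma extremal_subgraph (T : finType) (e : rel T) q :
  symmetric e -> irreflexive e -> 2 * trunc_log 2 q < q -> 0 < #|T| ->
  4 * q * #|T| <= adjacencies e [set: T] ->
  exists U : {set T}, [/\ U != set0,
    forall v, v \in U -> q < \sum_(y in U) e v y &
    forall (A B : {set T}) n, separation e U A B -> A != U -> B != U ->
      n <= trunc_log 2 #|A| -> n <= trunc_log 2 #|B| -> q + n <= 2 * #|A :&: B| ].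
Proof.
move=> se ie lgq T0 dense; have q0 : 0 < q by apply: leq_ltn_trans lgq.
pose P (U : {set T}) := (q <= #|U|) &&
  (4 * q * #|U| <= adjacencies e U + 2 * q * (q + trunc_log 2 #|U|)).
have PT : P [set: T].
  rewrite /P; have := adjacencies_le_square e [set: T]; rewrite cardsT => sq.
  rewrite (leq_trans dense (leq_addr _ _)) andbT.
  have := leq_trans dense sq; rewrite leq_pmul2r //; apply: leq_trans; rewrite -[leqLHS]mul1n leq_mul2r orbT //.
have [U /minsetP[/andP[Uq UP] minU] _] := minset_exists PT.
have small (A : {set T}) : A \subset U -> A != U -> q <= #|A| ->
    adjacencies e A + 2 * q * (q + trunc_log 2 #|A|) < 4 * q * #|A|.
  move=> AU AneU Aq; rewrite ltnNge; apply: contra AneU => AP; apply/eqP.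
  by apply: minU => //; rewrite /P Aq.
have Uq' : q < #|U|.
  rewrite ltn_neqAle Uq andbT; apply/eqP=> E; move: UP (adjacencies_le_square e U) lgq.
  by rewrite -E; clear; nia.
have deg v : v \in U -> q < \sum_(y in U) e v y.
  move=> vU; have cU : #|U| = #|U :\ v|.+1 by rewrite (cardsD1 v) vU.
  have ne : U :\ v != U by apply: contraTneq vU => <-; rewrite !inE eqxx.
  have := small _ (subsetDl _ _) ne; rewrite -ltnS -cU => /(_ Uq').
  have := adjacencies_rem se ie vU; move: UP; rewrite cU.
  have k0 : 0 < #|U :\ v| by rewrite -ltnS -cU; apply: leq_ltn_trans Uq'.
  have : trunc_log 2 #|U :\ v|.+1 <= (trunc_log 2 #|U :\ v|).+1.
    by apply: trunc_log2_leS => //; move: k0; clear; lia.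
  move: (adjacencies e U) (adjacencies e (U :\ v)) (\sum_(y in U) _) (trunc_log 2 #|U :\ v|.+1).
  move: (trunc_log 2 #|U :\ v|) (#|U :\ v|) => l n E E' s l'; clear; nia.
exists U; split=> // [|A B n sAB AU BU nA nB]; first by rewrite -card_gt0; apply: leq_trans Uq'.
have [UE noe] := separationP _ _ _ _ sAB.
have big (X Y : {set T}) : separation e U X Y -> Y != U -> q <= #|X|.
  move=> /separationP[XYE nXY] YU.
  have : ~~ (X \subset Y) by apply: contra YU => /setUidPr <-; rewrite XYE.
  case/subsetPn=> v vX vY; have vU : v \in U by rewrite -XYE inE vX.
  apply: ltnW; apply: leq_trans (deg v vU) _; rewrite -sum1_card big_mkcond [leqRHS]big_mkcond.
  apply: leq_sum => y _; case: ifP => // yU; case: ifP => [_|yX]; first exact: leq_b1.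
  have yY : y \in Y by move: yU; rewrite -XYE inE yX.
  by rewrite (negPf (nXY v y vX vY yY _)) // yX.
have AsU : A \subset U by rewrite -UE subsetUl.
have BsU : B \subset U by rewrite -UE subsetUr.
have sBA : separation e U B A by rewrite separationC.
have sA := small A AsU AU (big _ _ sAB BU).
have sB := small B BsU BU (big _ _ sBA AU).
have Es := adjacencies_separation se sAB.
have cU : #|U| + #|A :&: B| = #|A| + #|B| by rewrite -UE cardsUI.
have A0 : 0 < #|A| by apply: leq_trans q0 (big _ _ sAB BU).
have lg : trunc_log 2 #|U| + n <= (trunc_log 2 #|A| + trunc_log 2 #|B|).+1.
  case: (leqP #|A| #|B|) => AB.
    have : trunc_log 2 #|U| <= (trunc_log 2 #|B|).+1.
      by apply: trunc_log2_leS; [apply: leq_trans AB|move: cU AB; clear; lia].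
    by move: nA; clear; lia.
  have : trunc_log 2 #|U| <= (trunc_log 2 #|A|).+1.
    by apply: trunc_log2_leS => //; move: cU AB; clear; lia.
  by move: nB; clear; lia.
move: UP sA sB Es cU lg q0; clear.
move: (trunc_log 2 #|U|) (trunc_log 2 #|A|) (trunc_log 2 #|B|) (adjacencies e U) (adjacencies e A) (adjacencies e B).
move: #|U| #|A| #|B| #|A :&: B| => u a b s lu la lb eu ea eb.
nia.
Qed.

(** * The outer cycle from detours *)

Lemma index_next (T : eqType) (c : seq T) x :
  uniq c -> x \in c ->
  index (next c x) c = if (index x c).+1 < size c then (index x c).+1 else 0.
Proof.
move=> uc xc; rewrite next_nth xc; case: c uc xc => // y p uc xc.
have ix : index x (y :: p) < (size p).+1 by rewrite -index_mem in xc.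
case: ifP => lt.
  by rewrite -[nth y p _]/(nth y (y :: p) (index x (y :: p)).+1) index_uniq.
rewrite nth_default /= ?eqxx //; move: lt ix; rewrite /= ltnS; move: (index x _) => i; lia.
Qed.

Lemma nth_filter_count (T : Type) (x0 : T) (a : pred T) s i :
  i < size s -> a (nth x0 s i) -> nth x0 (filter a s) (count a (take i s)) = nth x0 s i.
Proof.
elim: s i => // x s IH [|i] /= si ai; first by rewrite ai.
by case: ifP => ax /=; rewrite ?add1n ?add0n /= IH.
Qed.

Lemma count_take_lt (T : Type) (x0 : T) (a : pred T) s i j :
  i < j -> j <= size s -> a (nth x0 s i) -> count a (take i s) < count a (take j s).
Proof.
move=> ij js ai.
have -> : take j s = take i s ++ nth x0 s i :: take (j - i.+1) (drop i.+1 s).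
  rewrite -[in LHS](cat_take_drop i s) take_cat size_takel; last by lia.
  rewrite ltnNge (ltnW ij) /= (drop_nth x0); last by lia.
  by have -> : j - i = (j - i.+1).+1 by lia.
by rewrite count_cat /= ai; lia.
Qed.

(** Ranks along the inner cycle grow along the outer one, while an edge of the
    inner cycle joins consecutive ranks or the two extreme ones. *)
Lemma subsequence_no_crossing (T : finType) (c1 c : seq T) :
  uniq c -> filter (mem c) c1 = c -> ~ crossing c1 c.
Proof.
move=> uc fc [i [j [i' [j' [ij ji ij' e1 e2]]]]].
pose x0 := tnth (in_tuple c1) i.
pose rk (n : 'I_(size c1)) := count (mem c) (take n c1).
have vE n : tnth (in_tuple c1) n = nth x0 c1 n by rewrite (tnth_nth x0).
rewrite !vE in e1 e2.
have sub x y : [set x; y] \in cycle_edges c -> x \in c /\ y \in c.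
  case/imsetP=> z zc E; have : x \in [set z; next c z] by rewrite -E !inE eqxx.
  have : y \in [set z; next c z] by rewrite -E !inE eqxx orbT.
  by rewrite !inE => /orP[]/eqP-> /orP[]/eqP->; rewrite ?mem_next.
have rkE (n : 'I_(size c1)) : nth x0 c1 n \in c -> index (nth x0 c1 n) c = rk n /\ rk n < size c.
  move=> nc; have lt : rk n < size c.
    rewrite -fc size_filter /rk -[in X in _ < X](take_size c1).
    by apply: (count_take_lt (x0 := x0)).
  split=> //; have := nth_filter_count (x0 := x0) (a := mem c) (ltn_ord n) nc.
  by rewrite fc -/(rk n) => <-; rewrite index_uniq.
have mono (m n : 'I_(size c1)) : m < n -> nth x0 c1 m \in c -> rk m < rk n.
  by move=> mn mc; apply: (count_take_lt (x0 := x0)) => //; apply: ltnW.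
have [ic ic'] := sub _ _ e1; have [jc jc'] := sub _ _ e2.
have [Ei li] := rkE _ ic; have [Ei' li'] := rkE _ ic'.
have lt1 := mono _ _ ij ic; have lt2 := mono _ _ ji jc; have lt3 := mono _ _ ij' ic'.
have [_ lj'] := rkE _ jc'.
case/imsetP: e1 => z zc E.
have nz : index (next c z) c = if (index z c).+1 < size c then (index z c).+1 else 0.
  exact: index_next.
have : nth x0 c1 i \in [set z; next c z] by rewrite -E !inE eqxx.
have : nth x0 c1 i' \in [set z; next c z] by rewrite -E !inE eqxx orbT.
move: Ei Ei' nz; move: (rk i) (rk j) (rk i') (rk j') li li' lt1 lt2 lt3 lj' => a b a' b' li li' lt1 lt2 lt3 lj'.
rewrite !inE => Ei Ei' nz /orP[]/eqP E2 /orP[]/eqP E1; rewrite E1 in Ei; rewrite E2 in Ei'.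
- by move: lt1 lt2; rewrite -Ei -Ei'; clear; lia.
- by move: nz lt1 lt2 lt3 lj'; rewrite Ei Ei'; clear; case: ifP; lia.
- by move: nz lt1 lt2 lt3 lj'; rewrite Ei Ei'; clear; case: ifP; lia.
- by move: lt1 lt2; rewrite -Ei -Ei'; clear; lia.
Qed.

Lemma path_flatten (T : eqType) (e : rel T) (I : T -> seq T) u s z :
  path (fun x y => path e x (rcons (I x) y)) u (rcons s z) ->
  path e u (rcons (I u ++ flatten [seq v :: I v | v <- s]) z).
Proof.
elim: s u => [|v s IH] u /=; first by rewrite andbT cats0.
case/andP=> uv /IH vs; rewrite -cat_cons -cat_rcons !rcons_cat cat_path uv last_rcons.
by rewrite -rcons_cat.
Qed.

Lemma uniq_flatten_map (S T : eqType) (g : S -> seq T) (s : seq S) :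
  uniq s -> (forall x, x \in s -> uniq (g x)) ->
  (forall x y w, x \in s -> y \in s -> w \in g x -> w \in g y -> x = y) ->
  uniq (flatten [seq g x | x <- s]).
Proof.
elim: s => //= x s IH /andP[xs us] ug dg; rewrite cat_uniq ug ?mem_head //=.
rewrite IH // ?andbT => [|y ys|y z w ys zs].
- apply/hasPn=> w /flatten_mapP[y ys wy]; apply/negP=> wx.
  by case/negP: xs; rewrite (dg x y w) // ?inE ?eqxx // ys orbT.
- by apply: ug; rewrite inE ys orbT.
- by apply: dg; rewrite inE ?ys ?zs orbT.
Qed.

(** Replacing each edge of the inner cycle by a detour outside it gives the outer
    cycle, which visits the inner one in its own order. *)
Lemma outer_cycle (T : finType) (e : rel T) (c : seq T) (I : T -> seq T) :
  graph_cycle e c ->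
  (forall u, u \in c ->
     [/\ path e u (rcons (I u) (next c u)), uniq (I u), 0 < size (I u) &
         forall w, w \in I u -> w \notin c]) ->
  (forall u u' w, u \in c -> u' \in c -> w \in I u -> w \in I u' -> u = u') ->
  exists c1 : seq T, graph_cycle e c1 /\ nested_without_crossings c1 c.
Proof.
move=> [c2 /andP[cc uc]] HI dI.
pose c1 := flatten [seq u :: I u | u <- c].
have uc1 : uniq c1.
  apply: uniq_flatten_map => // [u uc'|u u' w ucc ucc'].
    by have [_ uI _ nI] := HI u uc'; rewrite /= uI andbT; apply: contraL uc' => /nI.
  have [_ _ _ nI] := HI u ucc; have [_ _ _ nI'] := HI u' ucc'.
  rewrite !inE => /orP[/eqP->|wI] /orP[/eqP E|wI'] //.
  - by move: (nI' _ wI'); rewrite ucc.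
  - by move: (nI _ wI); rewrite E ucc'.
  - exact: dI wI wI'.
have fc : filter (mem c) c1 = c.
  have fI s : {subset s <= c} -> filter (mem c) (flatten [seq u :: I u | u <- s]) = s.
    elim: s => //= u s IH sub; have ucc : u \in c by apply: sub; rewrite mem_head.
    rewrite ucc filter_cat IH => [|x xs]; last by apply: sub; rewrite inE xs orbT.
    have [_ _ _ nI] := HI u ucc.
    by rewrite (eq_in_filter (a2 := pred0)) ?filter_pred0 // => w /nI /negPf.
  exact: fI.
have sub : {subset c <= c1}.
  by move=> u uc'; rewrite -fc mem_filter in uc'; case/andP: uc'.
have cyc1 : cycle e c1.
  have : cycle (fun x y => path e x (rcons (I x) y)) c.
    apply: (sub_in_cycle (P := mem c) (e := frel (next c))); last exact: cycle_next.
    - by move=> x y xc _ /= /eqP<-; have [] := HI x xc.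
    - exact/allP.
  rewrite /c1; case: (c) => //= u s /path_flatten; by rewrite rcons_cat.
have size1 : 2 < size c1 by apply: leq_trans c2 _; apply: uniq_leq_size.
have alt x : x \in c1 -> x \in c -> next c1 x \notin c.
  move=> xc1 xc; have [_ _ + nI] := HI x xc.
  case EI: (I x) => [//|y p] _; suff -> : next c1 x = y by apply: nI; rewrite EI mem_head.
  have Ec1 : exists s1 s2, c1 = s1 ++ x :: y :: s2.
    rewrite /c1; case/splitPr: xc => s1 s2; rewrite map_cat flatten_cat /= EI.
    by eexists; eexists; reflexivity.
  case: Ec1 => s1 [s2 Ec1]; have ix : index x c1 = size s1.
    move: uc1; rewrite Ec1 cat_uniq /= index_cat => /and3P[_ /norP[/negPf-> _] _].
    by rewrite /= eqxx addn0.
  have lt : (size s1).+1 < size c1 by rewrite Ec1 size_cat /= !addnS !ltnS leq_addr.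
  have := index_next uc1 xc1; rewrite ix lt => En.
  rewrite -(nth_index x (s := c1) (x := next c1 x)) ?mem_next // En Ec1 nth_cat.
  by rewrite ltnNge leqnSn /= subSnn.
exists c1; split; first by split=> //; apply/andP.
split; last exact: subsequence_no_crossing.
split=> //; rewrite -setI_eq0; apply/eqP/setP=> E; rewrite !inE; apply/negP.
case/andP=> /imsetP[x xc1 Ex] /imsetP[y yc Ey].
have inc z : z \in E -> z \in c.
  by rewrite Ey !inE => /orP[]/eqP->; rewrite ?mem_next.
by have := alt x xc1 (inc x _); rewrite (inc (next c1 x)) ?Ex ?inE ?eqxx ?orbT // => /(_ isT).
Qed.

(** * Shortest cycles *)

(** Without cycles the girth is unbounded, so balls would grow beyond #|T|. *)
Lemma shortest_cycle (T : finType) (e : rel T) (U : {set T}) :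
  symmetric e -> irreflexive e -> (forall x y, e x y -> y \in U) -> U != set0 ->
  (forall v, v \in U -> 4 <= \sum_w e v w) ->
  exists c, graph_cycle e c /\ girth_geq e (size c).
Proof.
move=> se ie eU /set0Pn[x xU] deg.
pose P n := (2 < n) && [exists c : n.-tuple T, ucycleb e c].
have PP c : graph_cycle e c -> P (size c).
  by move=> [c2 uc]; rewrite /P c2; apply/existsP; exists (in_tuple c).
have [n0 Pn0] : exists n, P n.
  case: (boolP [exists n : 'I_#|T|.+1, P n]) => [/existsP[n Pn]|/existsPn none]; first by exists n.
  have girth : girth_geq e (2 * #|T| + 2).
    move=> c gc; have [_ /andP[_ uc]] := gc.
    have lt : size c < #|T|.+1 by rewrite ltnS -(card_uniqP uc) max_card.
    by case/negP: (none (Ordinal lt)); apply: PP.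
  have xsub : [set x] \subset U by rewrite sub1set.
  have big : 2 ^ #|T| <= #|ball e [set x] #|T| |.
    apply: (ball_growth (k := 2 * #|T| + 2)) => //; first by rewrite addn1 addn2.
    by move=> v /(subsetP (ball_support _ eU xsub)); apply: deg.
  by have := leq_trans big (max_card _); rewrite leqNgt ltn_expl.
have exP : exists n, P n by exists n0.
case: (ex_minnP exP) => n /andP[n2 /existsP[c uc]] minn.
exists c; rewrite /girth_geq size_tuple; split; first by split=> //; rewrite size_tuple.
by move=> c' /PP/minn.
Qed.

(** The shorter of the two arcs of c from x to y. *)
Lemma cycle_arc (T : finType) (e : rel T) c x y :
  symmetric e -> graph_cycle e c -> x \in c -> y \in c ->
  exists p, [/\ path e x p && uniq (x :: p), last x p = y, 2 * size p <= size c,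
    {subset p <= c} & [\/ p = [::], ohead p = Some (next c x) | ohead p = Some (prev c x)]].
Proof.
move=> se [c2 /andP[cc uc]] xc yc.
have [i s rc] := rot_to xc.
have sc : size c = (size s).+1 by rewrite -(size_rot i) rc.
have mc z : (z \in c) = (z \in x :: s) by rewrite -(mem_rot i) rc.
have us : uniq (x :: s) by rewrite -rc rot_uniq.
have cs : cycle e (x :: s) by rewrite -rc rot_cycle.
have xs : x \notin s by case/andP: us.
have nx : next c x = head x s.
  rewrite -(next_rot i uc) rc next_nth mem_head /= eqxx; by case: (s).
have px : prev c x = last x s.
  by rewrite -(prev_rot i uc) rc prev_nth mem_head memNindex // (last_nth x).
move: yc; rewrite mc inE => /orP[/eqP->|ys].
  by exists [::]; split=> //; constructor 1.
have [s1 [s2 Es]] : exists s1 s2, s = s1 ++ y :: s2 by case/splitPr: ys => s1 s2; exists s1, s2.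
have sub z : z \in s -> z \in c by rewrite mc inE orbC => ->.
move: cs; rewrite /= Es rcons_cat /= -cat_rcons cat_path last_rcons => /andP[p1 p2].
have u12 : uniq (x :: s1 ++ y :: s2) by rewrite -Es.
case: (leqP (size s1) (size s2)) => lt.
  exists (rcons s1 y); split.
  - by move: u12; rewrite p1 -cat_rcons -cat_cons cat_uniq => /and3P[].
  - by rewrite last_rcons.
  - by move: lt; rewrite sc Es size_cat size_rcons /=; clear; lia.
  - by move=> z zs; apply: sub; rewrite Es -cat_rcons mem_cat zs.
  - by constructor 2; rewrite nx Es; case: (s1).
exists (rcons (rev s2) y); split.
- have -> : path e x (rcons (rev s2) y).
    have := rev_path e y (rcons s2 x); rewrite last_rcons belast_rcons rev_cons => ->.
    by rewrite (eq_path (e' := e)) // => u v; rewrite se.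
  rewrite -rev_cons rev_uniq mem_rev.
  move: u12; rewrite cons_uniq cat_uniq mem_cat negb_or => /andP[/andP[_ ->] /and3P[_ _ ->]] //.
- by rewrite last_rcons.
- by move: lt; rewrite sc Es size_cat size_rcons size_rev /=; clear; lia.
- by move=> z; rewrite mem_rcons inE mem_rev -in_cons => zs; apply: sub; rewrite Es mem_cat zs orbT.
- constructor 3; rewrite px Es last_cat /=; case/lastP: (s2) => [|s3 z] //=.
  by rewrite rev_rcons last_rcons.
Qed.

Lemma path_of_induced (T : finType) (e : rel T) (L : {set T}) x p :
  path (induced e L) x p -> path e x p /\ {subset p <= L}.
Proof.
elim: p x => //= y p IH x /andP[/and3P[_ yL xy] /IH[pp sub]]; rewrite xy pp.
by split=> // z; rewrite inE => /orP[/eqP->|/sub].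
Qed.

Lemma cycle_neighbour_unique (T : finType) (e : rel T) c w u u' :
  symmetric e -> graph_cycle e c -> girth_geq e (size c) -> 4 < size c ->
  w \notin c -> u \in c -> u' \in c -> e w u -> e w u' -> u = u'.
Proof.
move=> se gc girth c4 wc uc uc' wu wu'; apply/eqP; apply: contraT => ne.
have [p [/andP[pp up] lp sp sub _]] := cycle_arc se gc uc uc'.
have E : p = [:: w; u'].
  apply: (short_paths_eq se girth pp up) => //; first by rewrite /= se wu wu'.
    rewrite /= !inE !negb_or ne andbT; apply/andP; split; first by apply: contraNneq wc => <-.
    by rewrite andbT; apply: contraNneq wc => ->.
  by move: sp c4; rewrite /=; clear; lia.
by move: wc; rewrite sub // E mem_head.
Qed.

Lemma cycle_chordless (T : finType) (e : rel T) c w u :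
  symmetric e -> irreflexive e -> graph_cycle e c -> girth_geq e (size c) ->
  w \in c -> u \in c -> e w u -> u = next c w \/ u = prev c w.
Proof.
move=> se ie gc girth wc uc wu; have c2 : 2 < size c by case: gc.
have wnu : w != u by apply: contraTneq wu => ->; rewrite ie.
have [p [/andP[pp up] lp sp sub hp]] := cycle_arc se gc wc uc.
have E : p = [:: u].
  apply: (short_paths_eq se girth pp up) => //; rewrite /= ?wu ?inE ?wnu //.
  by move: sp c2; clear; lia.
by move: hp; rewrite E => -[//|[->]|[->]]; [left|right].
Qed.

(** Legs are edges from the cycle to the outside. If the balls around the ends of
    two legs met outside the cycle, the resulting path together with the shorter
    arc between the feet of the legs would close a cycle shorter than c. *)
Lemma legs_apart (T : finType) (e : rel T) c r u u' z z' v :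
  symmetric e -> irreflexive e -> graph_cycle e c -> girth_geq e (size c) ->
  4 * r + 4 < size c ->
  u \in c -> u' \in c -> z \notin c -> z' \notin c -> e u z -> e u' z' ->
  let e' := induced e (~: [set x in c]) in
  v \in ball e' [set z] r -> v \in ball e' [set z'] r -> z = z'.
Proof.
move=> se ie gc girth rk uc uc' zc zc' uz uz' e' vz vz'.
have se' : symmetric e' by apply: induced_sym.
have [p [pp lp sp]] := ball_path vz; have [p' [pp' lp' sp']] := ball_path vz'.
have [q [qp lq sq _]] := rev_walk se' pp'; rewrite lp' in qp lq.
have : path e' z (p ++ q) by rewrite cat_path pp lp.
case/walk_shorten=> s [ps us ls ss _]; rewrite last_cat lp lq in ls.
have [{}ps sub] := path_of_induced ps.
have {}ss : size s <= 2 * r.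
  by apply: leq_trans ss _; rewrite size_cat sq mul2n -addnn; apply: leq_add sp sp'.
have out x : x \in c -> x \notin z :: s.
  move=> xc; rewrite inE negb_or; apply/andP; split; first by apply: contraNneq zc => <-.
  by apply/negP=> /sub; rewrite !inE xc.
case: (eqVneq u u') => [Eu|ne].
  have E : [:: z'] = z :: s.
    apply: (short_paths_eq se girth (x := u)); rewrite ?ls //=.
    - by rewrite Eu uz'.
    - by rewrite inE andbT; apply: contraTneq uc => ->.
    - by rewrite uz.
    - by have := out u uc; move: us => /= -> ->.
    - by move: ss rk; clear; lia.
  by case: E.
have [a [/andP[pa ua] la sa suba _]] := cycle_arc se gc uc uc'.
have E : a = z :: rcons s u'.
  apply: (short_paths_eq se girth pa ua).
  - by rewrite /= uz rcons_path ps ls se.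
  - rewrite -rcons_cons cons_uniq rcons_uniq mem_rcons inE negb_or ne !out //=.
  - by rewrite /= last_rcons.
  - by rewrite /= size_rcons; move: sa ss rk; clear; lia.
by move: zc; rewrite suba // E mem_head.
Qed.

Lemma sum_le1 (T : finType) (S : {set T}) (P : pred T) :
  (forall x y, x \in S -> y \in S -> P x -> P y -> x = y) -> \sum_(x in S) P x <= 1.
Proof.
move=> H; rewrite -big_mkcondr /= sum1_card; apply/card_le1_eqP => x y.
by rewrite !unfold_in /= => /andP[xS Px] /andP[yS Py]; apply: H.
Qed.

(** * Doubling the shortest cycle *)

(** Each vertex x of the cycle c is split into (x, true), where a detour starts, and
    (x, false), where another one ends. The edges within c are dropped, so detours
    cannot use the edges of c or its chords. *)
Definition double (T : finType) (e : rel T) (c : seq T) : rel (T * bool) :=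
  [rel p p' | e p.1 p'.1 && ~~ ((p.1 \in c) && (p'.1 \in c))].

(** The copy (x, true) of a vertex outside c is discarded. *)
Definition double_verts (T : finType) (U : {set T}) (c : seq T) : {set T * bool} :=
  [set p | (p.1 \in U) && ((p.1 \in c) || ~~ p.2)].

Definition copies (T : finType) (c : seq T) : {set T * bool} := [set p | p.1 \in c].

Lemma card_copies (T : finType) (c : seq T) : uniq c -> #|copies c| = 2 * size c.
Proof.
move=> uc; have -> : copies c = setX [set x in c] [set: bool].
  by apply/setP=> -[x b]; rewrite !inE andbT.
by rewrite cardsX cardsT card_bool mulnC cardsE (card_uniqP uc).
Qed.

Lemma cycle_sub (T : finType) (e : rel T) (U : {set T}) c :
  (forall x y, e x y -> y \in U) -> cycle e c -> {subset c <= U}.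
Proof. by move=> eU cc x xc; apply: (eU (prev c x)); apply: prev_cycle. Qed.

Lemma sum_in_out (T : finType) (S : {set T}) (P : pred T) :
  \sum_w P w = \sum_(w in S) P w + \sum_(w in ~: S) P w.
Proof.
rewrite (bigID (fun w => w \in S)) /=; congr (_ + _).
by apply: eq_bigl => w; rewrite inE.
Qed.

(** A vertex of the cycle has many legs, and the balls around the ends of the legs
    are disjoint, so fewer than 2 #|I| vertices cannot meet the balls at all legs
    of I. If the cycle is short compared with the degrees, balls of radius 0 at
    the legs of a single vertex suffice. Otherwise the cycle is long enough for an
    outside vertex to belong to only one leg and for balls of radius r to be
    disjoint. *)
Lemma free_leg (T : finType) (e : rel T) (U I S : {set T}) c h r :
  symmetric e -> irreflexive e -> graph_cycle e c -> girth_geq e (size c) ->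
  (forall v, v \in U -> 2 * h < \sum_w e v w) -> {subset c <= U} -> {subset I <= c} ->
  2 < h -> r = 0 /\ 3 * size c <= 2 * h \/ 4 * r + 4 < size c ->
  #|S| < 2 * #|I| -> #|S| < 2 * size c ->
  exists u z, [/\ u \in I, e u z, z \notin c &
     [disjoint ball (induced e (~: [set x in c])) [set z] r & S]].
Proof.
move=> se ie gc girth deg cU Ic h2 cases SI Sc.
have [c2 /andP[_ uc]] := gc.
pose C := [set x in c]; set e' := induced _ _.
have cardC : #|C| = size c by rewrite cardsE (card_uniqP uc).
have out_deg u : \sum_(w in C) e u w + \sum_(w in ~: C) e u w = \sum_w e u w.
  by rewrite -sum_in_out.
have suffL (L : {set T}) : #|S| < #|L| ->
    (forall z, z \in L -> z \notin c /\ exists2 u, u \in I & e u z) ->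
    (forall z z' v, z \in L -> z' \in L -> v \in ball e' [set z] r -> v \in ball e' [set z'] r -> z = z') ->
    exists u z, [/\ u \in I, e u z, z \notin c & [disjoint ball e' [set z] r & S]].
  move=> SL HL dL; have lt := leq_ltn_trans (card_meeting S dL) SL.
  have : ~~ (L \subset [set z in L | ~~ [disjoint ball e' [set z] r & S]]).
    by apply/negP=> /subset_leq_card; rewrite leqNgt lt.
  case/subsetPn=> z zL; rewrite inE zL /= negbK => dz.
  by have [zc [u uI uz]] := HL z zL; exists u, z.
case: cases => [[r0 small]|rk].
  have /set0Pn[u uI] : I != set0 by rewrite -card_gt0; move: SI; case: #|I| => //; rewrite muln0.
  apply: (suffL [set z in ~: C | e u z]); last first.
  - by move=> z z' v _ _; rewrite r0 !inE => /eqP-> /eqP.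
  - by move=> z; rewrite !inE => /andP[zc uz]; split=> //; exists u.
  have -> : #|[set z in ~: C | e u z]| = \sum_(w in ~: C) e u w.
    by rewrite -sum1_card -big_mkcondr; apply: eq_bigl => z; rewrite inE.
  have H1 : \sum_(w in C) e u w <= size c.
    by rewrite -cardC -sum1_card; apply: leq_sum => w _; apply: leq_b1.
  have := deg u (cU _ (Ic _ uI)); rewrite -out_deg; move: H1 Sc small; clear; lia.
have ck : 4 < size c by move: rk; clear; lia.
pose L := [set z in ~: C | [exists u in I, e u z]].
apply: (suffL L).
- apply: leq_trans SI _.
  apply: leq_trans (_ : \sum_(u in I) \sum_(z in L) e u z <= _).
    rewrite mulnC -sum_nat_const; apply: leq_sum => u uI.
    have -> : \sum_(z in L) e u z = \sum_(z in ~: C) e u z.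
      rewrite [LHS]big_mkcond [RHS]big_mkcond; apply: eq_bigr => z _; rewrite !inE.
      case zc: (z \in c) => //=; case: exists_inP => // no.
      by case uz: (e u z) => //; case: no; exists u.
    have H1 : \sum_(w in C) e u w <= 2.
      apply: leq_trans (_ : \sum_(w in C) ((w == next c u) + (w == prev c u)) <= _).
        apply: leq_sum => w; rewrite inE => wc; case uw: (e u w) => //=.
        by case: (cycle_chordless se ie gc girth (Ic _ uI) wc uw) => ->; rewrite eqxx ?addn1.
      rewrite big_split /=; apply: (@leq_add _ _ 1 1); apply: sum_le1 => x y _ _ /eqP-> /eqP->//.
    have := deg u (cU _ (Ic _ uI)); rewrite -out_deg; move: H1 h2; clear; lia.
  rewrite exchange_big -sum1_card; apply: leq_sum => z; rewrite !inE => /andP[zc _].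
  apply: sum_le1 => x y /Ic xc /Ic yc xz yz.
  by apply: (cycle_neighbour_unique se gc girth ck zc xc yc); rewrite se.
- move=> z; rewrite !inE => /andP[zc /exists_inP[u uI uz]]; by split=> //; exists u.
move=> z z' v; rewrite !inE => /andP[zc /exists_inP[u uI uz]] /andP[zc' /exists_inP[u' uI' uz']].
by apply: (legs_apart se ie gc girth rk (Ic _ uI) (Ic _ uI')).
Qed.

Lemma girth_geq_sub (T : finType) (e e' : rel T) k :
  subrel e' e -> girth_geq e k -> girth_geq e' k.
Proof.
move=> sub girth c [c2 /andP[cc uc]]; apply: girth; split=> //; apply/andP; split=> //.
exact: sub_cycle cc.
Qed.

(** No separation of order below twice the length of the cycle can cut all the
    copies off from a large set D. Adding the cycle to both sides would turn it
    into a separation of U of order below 3 * size c. Its X side contains a ball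
    around the end of a free leg and its Y side contains D, so the expansion of U
    makes its order larger than that. *)
Lemma doubled_separation (T : finType) (e : rel T) (U D : {set T}) c m (X Y : {set T * bool}) :
  symmetric e -> irreflexive e -> graph_cycle e c -> girth_geq e (size c) ->
  (forall x y, e x y -> y \in U) ->
  (forall v, v \in U -> 2 * 2 ^ m < \sum_w e v w) ->
  (forall (A B : {set T}) n, separation e U A B -> A != U -> B != U ->
      n <= trunc_log 2 #|A| -> n <= trunc_log 2 #|B| -> 2 * 2 ^ m + n <= 2 * #|A :&: B|) ->
  48 <= m -> 66 <= 2 * 2 ^ m ->
  D \subset U -> D != set0 -> (forall x, x \in D -> x \notin c) ->
  (2 ^ m) ^ ((size c - 3) %/ 8) <= #|D| ->
  separation (double e c) (double_verts U c) X Y -> copies c \subset X ->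
  (forall x, x \in D -> (x, false) \notin X) ->
  2 * size c <= #|X :&: Y|.
Proof.
move=> se ie gc girth eU deg ext m48 q66 DU D0 Dc bigD /separationP[VE sXY] /subsetP cX DX.
have [c2 /andP[cc uc]] := gc.
have cU := cycle_sub eU cc.
rewrite leqNgt; apply/negP => small.
pose C := [set x in c]; have cardC : #|C| = size c by rewrite cardsE (card_uniqP uc).
have CU : C \subset U by apply/subsetP=> x; rewrite inE; apply: cU.
pose side (W : {set T * bool}) := [set x in U | (x \notin c) && ((x, false) \in W)].
pose S := side X :&: side Y.
pose I := [set u in c | ((u, true) \notin Y) || ((u, false) \notin Y)].
have XY x : x \in U -> x \notin c -> ((x, false) \in X) || ((x, false) \in Y).
  by move=> xU xc; rewrite -in_setU VE inE /= xU orbT.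
have sepU : separation e U (side X :|: C) (side Y :|: C).
  apply/separationP; split.
    rewrite setUACA setUid; apply/setP=> x; rewrite !inE.
    case xc: (x \in c); first by rewrite !orbT cU.
    rewrite !orbF; case xU: (x \in U) => //=; exact: (XY x xU (negbT xc)).
  move=> x y; rewrite !inE !negb_or => xX /andP[xY xc] yY /andP[yX yc].
  rewrite (negPf xc) (negPf yc) !orbF /= in xX xY yY yX.
  case/andP: xX => xU xX; case/andP: yY => yU yY; rewrite xU yU /= in xY yX.
  by have := sXY (x, false) (y, false) xX xY yY yX; rewrite /double /= (negPf xc) andbT.
have cut : #|(side X :|: C) :&: (side Y :|: C)| <= #|S| + size c.
  by rewrite -setUIl -cardC; apply: leq_card_setU.
have cutS : #|copies c :&: Y| + #|S| <= #|X :&: Y|.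
  have inj : injective (fun x : T => (x, false)) by move=> x y [].
  rewrite -(card_imset S inj) -cardsUI.
  have -> : (copies c :&: Y) :&: [set (x, false) | x in S] = set0.
    apply/setP=> p; rewrite !inE; apply/negP=> /andP[/andP[pc _] /imsetP[x xS E]].
    by move: xS pc; rewrite E !inE /= => /andP[/and3P[_ /negPf->]].
  rewrite cards0 addn0; apply: subset_leq_card; apply/subsetP=> p /setUP[].
    by case/setIP=> /cX pX pY; rewrite inE pX.
  by case/imsetP=> x + ->; rewrite !inE => /andP[/and3P[_ _ ->] /and3P[_ _ ->]].
have cutI : #|copies c :\: Y| <= 2 * #|I|.
  rewrite mulnC -card_bool -cardsT -cardsX; apply: subset_leq_card; apply/subsetP=> -[x b].
  by rewrite !inE andbT /= => /andP[xY ->]; case: b xY => ->; rewrite ?orbT.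
have cCp := card_copies uc; have := cardsID Y (copies c); rewrite cCp => cID.
have SI : #|S| < 2 * #|I| by move: small cutS cutI cID; clear; lia.
have Sc : #|S| < 2 * size c by move: small cutS; clear; lia.
have Ic : {subset I <= c} by move=> u; rewrite inE => /andP[].
have leg u z : u \in I -> e u z -> z \notin c -> z \in side X.
  move=> uI uz zc; rewrite inE (eU _ _ uz) zc /=; apply: contraT => zX.
  have zY : (z, false) \in Y by move: (XY z (eU _ _ uz) zc); rewrite (negPf zX).
  have [b bY] : exists b, (u, b) \notin Y.
    by move: uI; rewrite inE => /andP[_ /orP[]]; [exists true|exists false].
  have bX : (u, b) \in X by apply: cX; rewrite inE /=; apply: Ic.
  by have := sXY _ _ bX bY zY zX; rewrite /double /= uz (negPf zc) andbF.
(* For a short cycle the term 2 * 2 ^ m settles the matter; the balls, which need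
   not be disjoint then, shrink to points. *)
pose r := if 3 * size c <= 2 ^ m then 0 else (size c - 3) %/ 8.
have cases : r = 0 /\ 3 * size c <= 2 * 2 ^ m \/ 4 * r + 4 < size c.
  rewrite /r; case: (leqP (3 * size c) (2 ^ m)) => [le|lt]; [left|right].
    by split=> //; apply: leq_trans le (leq_pmull _ _).
  by move: lt q66; clear; lia.
have h2 : 2 < 2 ^ m by move: q66; clear; lia.
have [u [z [uI uz zc dz]]] := free_leg se ie gc girth deg cU Ic h2 cases SI Sc.
set e' := induced e _ in dz; have {}dz := disjoint_notinP _ _ dz.
have se' : symmetric e' by apply: induced_sym.
have zX := leg u z uI uz zc.
(* The ball around the leg does not meet S, so it stays on the X side. *)
have ballX n v : n <= r -> v \in ball e' [set z] n -> v \in side X /\ v \notin side Y.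
  have inS w : w \in side X -> w \in ball e' [set z] r -> w \notin side Y.
    by move=> wX wB; move: (dz w wB); rewrite inE wX.
  elim: n v => [|n IH] v nr; first by rewrite inE => /eqP->; split=> //; apply: inS; rewrite // (subsetP (subset_ball _ _ (leq0n r))) // inE.
  move=> vB; suff vX : v \in side X by split=> //; apply: inS; rewrite // (subsetP (subset_ball _ _ nr)).
  case/ballSP: vB => [vB|[w wB /and3P[wC vC wv]]]; first by have [] := IH v (ltnW nr) vB.
  have [wX wY] := IH w (ltnW nr) wB; rewrite !inE in wC vC.
  rewrite inE (eU _ _ wv) vC /=; apply: contraT => vX.
  have vY : (v, false) \in Y by move: (XY v (eU _ _ wv) vC); rewrite (negPf vX).
  move: wX wY; rewrite !inE wC => /andP[wU wX]; rewrite wU /= => wY.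
  by have := sXY _ _ wX wY vY vX; rewrite /double /= wv (negPf wC).
have zY : z \notin side Y by have [] := ballX 0 z (leq0n r) (set11 z).
have BneU : side Y :|: C != U.
  apply/negP=> /eqP E; have : z \in side Y :|: C by rewrite E (eU _ _ uz).
  by rewrite in_setU (negPf zY) inE (negPf zc).
have AneU : side X :|: C != U.
  case/set0Pn: D0 => x xD; apply/negP=> /eqP E.
  have : x \in side X :|: C by rewrite E (subsetP DU).
  by rewrite !inE (negPf (DX x xD)) (negPf (Dc x xD)) !andbF.
have lg (k : nat) (W : {set T}) : (2 ^ m) ^ k <= #|W| -> m * k <= trunc_log 2 #|W|.
  by move=> le; apply: trunc_log_max => //; rewrite expnM.
have bigA : (2 ^ m) ^ r <= #|side X :|: C|.
  apply: leq_trans (_ : #|ball e' [set z] r| <= _).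
    case r0: r cases => [|r'] cases; first by rewrite expn0 cards1.
    apply: (ball_growth (k := size c)) => //.
    - by move=> x; rewrite /e' /induced /= ie !andbF.
    - by apply: girth_geq_sub girth => x y /and3P[].
    - by move: cases; clear; lia.
    move=> v /(ballX _ _ (eq_leq (esym r0))) [+ _]; rewrite inE => /and3P[vU vc _].
    have := deg v vU; rewrite (sum_in_out C).
    have H1 : \sum_(w in C) e v w <= 1.
      apply: sum_le1 => x y; rewrite !inE => xc yc vx vy.
      by apply: (cycle_neighbour_unique se gc girth _ vc xc yc vx vy); move: cases; clear; lia.
    have H2 : \sum_(w in ~: C) e v w <= \sum_w e' v w.
      rewrite big_mkcond; apply: leq_sum => w _; rewrite /e' /induced /= !inE vc /=.
      by case: (w \in c).
    by move: H1 H2; clear; lia.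
  apply: subset_leq_card; apply/subsetP=> v /(ballX r v (leqnn r))[vX _].
  by rewrite inE vX.
have bigB : (2 ^ m) ^ r <= #|side Y :|: C|.
  apply: leq_trans (_ : (2 ^ m) ^ ((size c - 3) %/ 8) <= _).
    rewrite leq_pexp2l //; first by rewrite expn_gt0.
    by rewrite /r; case: ifP.
  apply: leq_trans bigD _; apply: subset_leq_card; apply/subsetP=> x xD.
  by rewrite !inE (subsetP DU) // Dc //; move: (XY x (subsetP DU _ xD) (Dc _ xD)); rewrite (negPf (DX _ xD)) /= => ->.
have := ext _ _ (m * r) sepU AneU BneU (lg _ _ bigA) (lg _ _ bigB).
have cut3 : #|(side X :|: C) :&: (side Y :|: C)| < 3 * size c by move: cut Sc; clear; lia.
move: cut3 m48 q66 cases; rewrite /r; case: (leqP (3 * size c) (2 ^ m)) => [le|_] cut3 m48 q66 cases.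
  by rewrite muln0 addn0; move: le cut3; clear; lia.
(* With r = (size c - 3) %/ 8 rounding gives 6 * size c <= 48 * r + 60. *)
have : 48 * ((size c - 3) %/ 8) <= m * ((size c - 3) %/ 8) by rewrite leq_mul2r m48 orbT.
by move: cut3 q66; clear; lia.
Qed.

(** * Linking the copies *)

Lemma doubled_model (T : finType) (e : rel T) (U : {set T}) c t (A : nat -> {set T})
    (J : {set 'I_t}) :
  clique_model e U A [pred i | i < t] ->
  (forall i x, i \in J -> x \in A i -> x \notin c) ->
  clique_model (add_clique (double e c) (copies c)) (double_verts U c)
    (fun i : 'I_t => [set (x, false) | x in A i]) (mem J).
Proof.
move=> [M1 M2 M3] out.
split=> [i iJ|i j p iJ jJ /imsetP[x xA ->] /imsetP[y yA [E]]|i j iJ jJ ij].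
- have [/subsetP s /set0Pn[x xA] cA] := M1 i (ltn_ord i); split.
  + by apply/subsetP=> _ /imsetP[y yA ->]; rewrite inE /= orbT s.
  + by apply/set0Pn; exists (x, false); apply: imset_f.
  + apply: conn_image cA => // y z yA _ yz _.
    by rewrite /add_clique /double /= yz (negPf (out i y iJ yA)).
- by apply: val_inj; apply: (M2 _ _ x (ltn_ord i) (ltn_ord j) xA); rewrite E.
have [x [y [xA yA xy]]] := M3 i j (ltn_ord i) (ltn_ord j) ij.
exists (x, false), (y, false); rewrite !imset_f //; split=> //.
by rewrite /add_clique /double /= xy (negPf (out i x iJ xA)).
Qed.

(** The set F u joins (u, true) to (next c u, false) and contains no other copy, so
    a path in it projects to a detour from u to next c u that avoids the rest of
    the cycle. *)
Lemma detours (T : finType) (e : rel T) (U : {set T}) c (F : T -> {set T * bool}) :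
  graph_cycle e c -> {subset c <= U} ->
  (forall u, conn (double e c) (F u) /\ F u \subset double_verts U c) ->
  (forall p, p \in copies c -> p \in F (if p.2 then p.1 else prev c p.1)) ->
  (forall u u' p, p \in F u -> p \in F u' -> u = u') ->
  exists I : T -> seq T,
    (forall u, u \in c ->
     [/\ path e u (rcons (I u) (next c u)), uniq (I u), 0 < size (I u) &
         forall w, w \in I u -> w \notin c]) /\
    (forall u u' w, u \in c -> u' \in c -> w \in I u -> w \in I u' -> u = u').
Proof.
move=> [c2 /andP[cc uc]] cU F1 F2 F3.
have one u : exists s : seq T, u \in c ->
    [/\ path e u (rcons s (next c u)), uniq s, 0 < size s &
        forall w, w \in s -> w \notin c /\ (w, false) \in F u].
  case uc': (u \in c); last by exists [::].
  have [cF /subsetP sF] := F1 u; have nc : next c u \in c by rewrite mem_next.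
  have uF : (u, true) \in F u by apply: (F2 (u, true)); rewrite inE.
  have nF : (next c u, false) \in F u.
    by have := F2 (next c u, false); rewrite inE /= prev_next //; apply.
  have /connectP[p0 pp0 lp0] := cF _ _ uF nF.
  have [p [pp up lp _ _]] := walk_shorten pp0; rewrite -lp0 in lp.
  have [{}pp subp] := path_of_induced pp.
  case/lastP: p lp pp up subp => [//|p q]; rewrite last_rcons => -> pp up subp.
  have out x b : (x, b) \in p -> x \notin c /\ b = false.
    move=> xp; have xF : (x, b) \in F u by apply: subp; rewrite mem_rcons inE xp orbT.
    have xNc : x \notin c.
      apply/negP=> xc; have /F2 xF' : (x, b) \in copies c by rewrite inE.
      have := F3 _ _ _ xF xF'; move: up; rewrite cons_uniq rcons_uniq mem_rcons inE negb_or => /and3P[/andP[_ up] np _].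
      case: b xp {xF xF'} => /= xp E; first by rewrite E xp in up.
      by move: np; rewrite E next_prev // xp.
    by split=> //; move: (sF _ xF); rewrite inE /= (negPf xNc) /= => /andP[_ /negPf].
  exists (map fst p) => _; split.
  - have : path e (u, true).1 (map fst (rcons p (next c u, false))).
      by rewrite path_map; apply: sub_path pp => x y /andP[].
    by rewrite map_rcons.
  - rewrite map_inj_in_uniq; first by move: up; rewrite cons_uniq rcons_uniq => /and3P[].
    by move=> [x b] [y b'] /out[_ ->] /out[_ ->] /= ->.
  - rewrite size_map; case: (p) pp => //=; rewrite andbT /double /= uc' nc /=.
    by rewrite andbF.
  move=> w /mapP[[x b] xp ->] /=; have [xc b0] := out x b xp; split=> //.
  by apply: subp; rewrite mem_rcons inE -b0 xp orbT.
have [I HI] := fin_all_exists one.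
exists I; split=> [u uc'|u u' w uc1 uc2 wI wI'].
  by have [p1 p2 p3 p4] := HI u uc'; split=> // w /p4[].
have [_ _ _ H] := HI u uc1; have [_ _ _ H'] := HI u' uc2.
by apply: (F3 _ _ (w, false)); [case: (H w wI)|case: (H' w wI')].
Qed.

(** The shortest cycle of the extremal subgraph is the inner cycle. Of the 5 k
    branch sets at most k meet this cycle of length k, which leaves the 4 k needed
    to link its 2 k copies. *)
Lemma dense_graph_nested_cycles (T : finType) (e : rel T) m :
  symmetric e -> irreflexive e -> 50 <= m -> 0 < #|T| ->
  4 * (2 * 2 ^ m) * #|T| <= adjacencies e [set: T] ->
  exists c1 c2 : seq T, [/\ graph_cycle e c1, graph_cycle e c2 & nested_without_crossings c1 c2].
Proof.
move=> se ie m50 T0 dense.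
have lgq : 2 * trunc_log 2 (2 * 2 ^ m) < 2 * 2 ^ m.
  rewrite -expnS trunc_expnK // expnS ltn_pmul2l //; case: m m50 {dense} => // m m50.
  by rewrite expnS; have := ltn_expl m (isT : 1 < 2); move: m50; clear; lia.
have q66 : 66 <= 2 * 2 ^ m.
  have : 2 ^ 6 <= 2 ^ m by rewrite leq_pexp2l //; apply: leq_trans m50.
  by move: (2 ^ m) => x; rewrite -[2 ^ 6]/64; clear; lia.
have [U [U0 deg0 ext0]] := extremal_subgraph se ie lgq T0 dense.
pose eU := induced e U.
have seU : symmetric eU by apply: induced_sym.
have ieU : irreflexive eU by move=> x; rewrite /eU /induced /= ie !andbF.
have sub : subrel eU e by move=> x y /and3P[].
have eUU x y : eU x y -> y \in U by case/and3P.
have deg v : v \in U -> 2 * 2 ^ m < \sum_w eU v w.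
  move=> vU; apply: leq_trans (deg0 v vU) _; rewrite big_mkcond; apply: leq_sum => w _.
  by rewrite /eU /induced /= vU /=; case: (w \in U).
have ext (A B : {set T}) n : separation eU U A B -> A != U -> B != U ->
    n <= trunc_log 2 #|A| -> n <= trunc_log 2 #|B| -> 2 * 2 ^ m + n <= 2 * #|A :&: B|.
  move=> /separationP[UE sAB]; apply: ext0; apply/separationP; split=> // x y xA xB yB yA.
  by have := sAB x y xA xB yB yA; rewrite /eU /induced /= -UE !inE xA yB orbT.
have [c [gc girth]] : exists c, graph_cycle eU c /\ girth_geq eU (size c).
  apply: (shortest_cycle seU ieU eUU U0) => v /deg; apply: leq_trans.
  exact: leq_trans (leqW q66).
have [c2 /andP[cc uc]] := gc; have cU := cycle_sub eUU cc.
pose k := size c; pose r := (k - 3) %/ 8.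
have [A [MA bigA]] : exists A : nat -> {set T},
    clique_model eU U A [pred i | i < 5 * k] /\ forall i, i < 5 * k -> (2 ^ m) ^ r <= #|A i|.
  apply: (girth_clique_model (k := k)) => //.
  - by rewrite /r; move: c2; rewrite -/k; clear; lia.
  - by move=> v /deg/ltnW.
  apply: leq_trans (_ : (2 ^ m) ^ r.+1 <= _).
    (* Rounding gives size c <= 8 * r + 10. *)
    rewrite -expnM leq_pexp2l //; apply: leq_trans (_ : 50 * r.+1 <= _); last by rewrite leq_mul2r m50 orbT.
    by rewrite /r; move: c2; rewrite -/k; clear; lia.
  rewrite expnS leq_mul2r; apply/orP; right; move: q66; clear; lia.
have [M1 M2 M3] := MA.
pose C := [set x in c]; have cardC : #|C| = k by rewrite cardsE (card_uniqP uc).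
pose J := [set i : 'I_(5 * k) | [disjoint A i & C]].
have cJ : 2 * #|copies c| <= #|J|.
  have meet : #|[set i in [set: 'I_(5 * k)] | ~~ [disjoint A i & C]]| <= #|C|.
    by apply: card_meeting => i j x _ _ xi xj; apply: val_inj; apply: (M2 _ _ x (ltn_ord i) (ltn_ord j)).
  have E : [set i in [set: 'I_(5 * k)] | ~~ [disjoint A i & C]] = ~: J.
    by apply/setP=> i; rewrite !inE.
  rewrite E cardC in meet; have := cardsC J; rewrite card_ord card_copies // -/k.
  by move=> EJ; rewrite -(leq_add2r #|~: J|) EJ mulnA mulSn addnC leq_add2r.
have out (i : 'I_(5 * k)) x : i \in J -> x \in A i -> x \notin c.
  by rewrite inE => dA xA; move: (disjoint_notinP _ _ dA x xA); rewrite inE.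
have [F [F1 F2 F3]] : exists F : T -> {set T * bool},
    [/\ forall u, conn (double eU c) (F u) /\ F u \subset double_verts U c,
        forall p, p \in copies c -> p \in F (if p.2 then p.1 else prev c p.1) &
        forall u u' p, p \in F u -> p \in F u' -> u = u'].
  apply: (linking (fun p : T * bool => if p.2 then p.1 else prev c p.1) _ _ cJ (doubled_model MA out)).
  - by move=> p p'; rewrite /double /= seU [(p.1 \in c) && _]andbC.
  - by apply/subsetP=> p; rewrite !inE => pc; rewrite cU // pc.
  move=> i X Y iJ sXY cX dX; rewrite card_copies //.
  have [sA A0 _] := M1 i (ltn_ord i).
  apply: (doubled_separation seU ieU gc girth eUU deg ext _ q66 sA A0 _ _ sXY cX).
  - exact: leq_trans m50.
  - by move=> x; apply: out iJ.
  - exact: bigA.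
  by move=> x xA; rewrite (disjointFr dX) ?imset_f.
have [I [I1 I2]] := detours gc cU F1 F2 F3.
have [c1 [gc1 n1]] := outer_cycle gc I1 I2.
have up c' : graph_cycle eU c' -> graph_cycle e c'.
  by move=> [c'2 /andP[cc' uc']]; split=> //; apply/andP; split=> //; apply: sub_cycle cc'.
by exists c1, c; split=> //; apply: up.
Qed.

(** * The theorem *)

Lemma adjacencies_of_avg_degree (T : finType) (e : rel T) (d : nat) :
  0 < d -> ((2 * d)%:R <= avg_degree e :> rat)%R ->
  0 < #|T| /\ d * #|T| <= adjacencies e [set: T].
Proof.
move=> d0; rewrite /avg_degree; have [T0|T0] := posnP #|T|.
  by rewrite T0 invr0 mulr0 lern0 muln_eq0 /= eqn0Ngt d0.
rewrite ler_pdivlMr ?ltr0n // -natrM ler_nat -mulnA leq_pmul2l // => le; split=> //.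
apply: leq_trans le _; rewrite adjacenciesE.
have -> : [set p : T * T | [&& p.1 \in [set: T], p.2 \in [set: T] & e p.1 p.2]] =
    [set p | e p.1 p.2] by apply/setP=> p; rewrite !inE.
apply: leq_trans (leq_imset_card _ _) _.
by apply: subset_leq_card; apply/subsetP=> p; rewrite inE.
Qed.

Theorem theorem1p1 :
  exists C : rat, (0 < C)%R /\
    forall (T : finType) (e : rel T),
      simple_graph e -> (C <= avg_degree e)%R ->
      exists c1 c2 : seq T,
        [/\ graph_cycle e c1, graph_cycle e c2 &
            nested_without_crossings c1 c2].
Proof.
(* The exponent is kept abstract so that 2 ^ m is never computed. *)
have [m m50] : exists m, 50 <= m by exists 50.
have d0 : 0 < 4 * (2 * 2 ^ m) by rewrite !muln_gt0 expn_gt0.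
exists (2 * (4 * (2 * 2 ^ m)))%:R%R; split; first by rewrite ltr0n muln_gt0.
move=> T e [se ie] /(adjacencies_of_avg_degree d0)[T0 dense].
exact: dense_graph_nested_cycles se ie m50 T0 dense.
Qed.
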